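(* Let $n\ge 2$ and let $\lambda=(a,1^b)\vdash n$ be a hook partition (with $a\ge 1$, $b\ge 0$, $a+b=n$), and assume $\lambda\neq(2,1)$. Put $\tilde\lambda=(a-1,b)$, a composition of $n-1$. Then there is an isomorphism of $C_n$-modules $$S^\lambda_{\mathsf{Sch}}\;\cong\;\bigoplus_{\mu\vdash n-1}K_{\mu\tilde\lambda}\,S^\mu_{\pi_{n-1}},$$ where $K_{\mu\tilde\lambda}$ are the Kostka numbers, i.e. $S^\mu_{\pi_{n-1}}$ occurs with multiplicity $K_{\mu\tilde\lambda}$.
   Context: All representations are over $\mathbb{C}$; $S_m$ is the symmetric group on $\{1,\dots,m\}$, and $S^\mu$ ($\mu\vdash m$) is its irreducible Specht module. A composition may have zero parts and need not be weakly decreasing. Cactus group. For $J=[a,b]=\{a,\dots,b\}\subseteq[1,n]$ let $w_J\in S_n$ be the permutation with $a+i\mapsto b-i$ for $0\le i\le b-a$, fixing all points outside $J$. For $n\ge2$ the cactus group $C_n$ is generated by $c_J$, $J\in\{[a,b] : 1\le a<b\le n\}$, subject to $c_J^2=1$; $c_Jc_K=c_Kc_J$ if $J\cap K=\emptyset$; and $c_Jc_K=c_{w_J(K)}c_J$ if $K\subseteq J$. The module $S^\mu_{\pi_{n-1}}$. There is a surjective homomorphism $\pi_{n-1}:C_n\to S_{n-1}$ given by $c_{[a,b]}\mapsto w_{[a,b-1]}$ if $b-a>1$ and $c_{[a,b]}\mapsto 1$ otherwise. For $\mu\vdash n-1$, $S^\mu_{\pi_{n-1}}$ is $S^\mu$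 regarded as a $C_n$-module via $\pi_{n-1}$. Kostka numbers. $K_{\mu\nu}$ is the number of semistandard Young tableaux of shape $\mu$ and content $\nu$ (with exactly $\nu_i$ entries equal to $i$). Schützenberger involutions. $\mathrm{SYT}(\lambda)$ is the set of standard Young tableaux of shape $\lambda$ with entries $1,\dots,n$. The promotion $\partial$ of a standard tableau with $m$ boxes is: replace the box labelled $1$ by an empty (dummy) box; repeatedly swap the dummy box with the smaller of its neighbours immediately to the east and to the south (or with the only such neighbour) until it has neither; subtract $1$ from all remaining labels; label the dummy box $m$. For $T\in\mathrm{SYT}(\lambda)$ let $T|_{[1,k]}$ be the part of $T$ with entries in $[1,k]$, and let $\partial_k$ apply $\partial$ to $T|_{[1,k]}$, leaving all boxes with entries $>k$ unchanged ($\partial_1$ is the identity). Set $\xi_{[1,k]}=\partial_1\circ\partial_2\circ\cdots\circ\partial_k$ for $2\le k\le n$, and $\xi_{[a,b]}=\xi_{[1,b]}\circ\xi_{[1,b-a+1]}\circ\xi_{[1,b]}$ for $1\le a<b\le n$. The assignment $c_J\mapsto\xi_J$ defines an action of $C_n$ on $\mathrm{SYT}(\lambda)$. Schützenberger module. Let $\{b_T : T\in\mathrm{SYT}(\lambda)\}$ be the Kazhdan–Lusztig basis of $S^\lambda$ (the specialisation at $q=1$ of the Kazhdan–Lusztig basis of the corresponding cell module of the Iwahori–Hecke algebra, indexed by standard tableaux). $S^\lambda_{\mathsf{Sch}}$ is the vector space $S^\lambda$ with the $C_n$-action $c_J\cdot b_T=b_{\xi_J(T)}$; thus it is the permutation module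 of the $C_n$-set $\mathrm{SYT}(\lambda)$. *)

(* Defs.v *)
From HB Require Import structures.
From mathcomp Require Import all_boot all_order all_algebra all_fingroup.
From mathcomp Require Import boolp reals complex zify.

Set Implicit Arguments.
Unset Strict Implicit.
Unset Printing Implicit Defensive.

Import GRing.Theory.

Local Open Scope ring_scope.

(* The element i : 'I_m stands for i + 1, so that 'S_m is the symmetric group
   on {1, ..., m}. *)

Definition reverse_in (a b x : nat) : nat :=
  if (a <= x <= b)%N then (a + b - x)%N else x.

Definition reversal_fun (m a b : nat) (i : 'I_m) : 'I_m :=
  if (0 < a)%N && (b <= m)%N then insubd i (reverse_in a b i.+1).-1 else i.

Lemma reversal_funE m a b (i : 'I_m) : (0 < a)%N -> (b <= m)%N ->
  (reversal_fun a b i).+1 = reverse_in a b i.+1.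
Proof.
move=> a0 bm; rewrite /reversal_fun a0 bm /= val_insubd /reverse_in.
by have := ltn_ord i; case: (boolP (a <= i.+1 <= b)%N) => ? /=; case: ifP => /=; lia.
Qed.

Lemma reversal_fun_inj m a b : injective (@reversal_fun m a b).
Proof.
have [/andP[a0 bm]|N] := boolP ((0 < a)%N && (b <= m)%N); last first.
  by move=> i j; rewrite /reversal_fun (negbTE N).
move=> i j /(congr1 (fun k : 'I_m => k.+1)); rewrite !reversal_funE //.
rewrite /reverse_in => H; apply: ord_inj.
by move: H; case: ifP => ?; case: ifP => ?; lia.
Qed.

(* w_[a,b] in S_m, when [a,b] is contained in [1,m] (otherwise it is 1). *)
Definition reversal (m a b : nat) : 'S_m := perm (@reversal_fun_inj m a b).

Lemma reversalE m a b (i : 'I_m) : (0 < a)%N -> (b <= m)%N ->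
  (reversal m a b i).+1 = reverse_in a b i.+1.
Proof. by move=> a0 bm; rewrite permE reversal_funE. Qed.

Definition interval n := {J : 'I_n.+1 * 'I_n.+1 | (0 < J.1 < J.2)%N}.

Definition lo n (J : interval n) : nat := (val J).1.
Definition hi n (J : interval n) : nat := (val J).2.

Lemma intervalP n (J : interval n) : [/\ 0 < lo J, lo J < hi J & hi J <= n]%N.
Proof.
by case: J => -[a b] /= /[dup] /andP[? ?] ?; split=> //; rewrite -ltnS ltn_ord.
Qed.

Definition interval_set n (J : interval n) : {set 'I_n} :=
  [set i : 'I_n | (lo J <= i.+1 <= hi J)%N].

Definition w n (J : interval n) : 'S_n := reversal n (lo J) (hi J).

Definition cactus_relations (n : nat) (G : groupType) (c : interval n -> G) :=
  [/\ forall J, (c J * c J)%g = 1%g,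
      forall J K, [disjoint interval_set J & interval_set K] ->
        (c J * c K)%g = (c K * c J)%g
    & forall J K L, interval_set K \subset interval_set J ->
        interval_set L = w J @: interval_set K ->
        (c J * c K)%g = (c L * c J)%g].

(* The generators are involutions, so every element of C_n is represented by a
   word in the generators: C_n is the quotient of the free monoid on them by
   the congruence that the relations generate. *)
Inductive cactus_congr n : seq (interval n) -> seq (interval n) -> Prop :=
| congr_refl u : cactus_congr u u
| congr_sym u v : cactus_congr u v -> cactus_congr v u
| congr_trans u v t : cactus_congr u v -> cactus_congr v t -> cactus_congr u t
| congr_cat u u' v v' : cactus_congr u u' -> cactus_congr v v' ->
    cactus_congr (u ++ v) (u' ++ v')
| congr_invol J : cactus_congr [:: J; J] [::]
| congr_disjoint J K : [disjoint interval_set J & interval_set K] ->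
    cactus_congr [:: J; K] [:: K; J]
| congr_nested J K L : interval_set K \subset interval_set J ->
    interval_set L = w J @: interval_set K ->
    cactus_congr [:: J; K] [:: L; J].

Definition cactus_rel n : rel (seq (interval n)) :=
  fun u v => `[< cactus_congr u v >].

Lemma cactus_rel_refl n : reflexive (@cactus_rel n).
Proof. by move=> u; apply/asboolP; exact: congr_refl. Qed.

Lemma cactus_rel_sym n : symmetric (@cactus_rel n).
Proof. by move=> u v; apply/asboolP/asboolP; exact: congr_sym. Qed.

Lemma cactus_rel_trans n : transitive (@cactus_rel n).
Proof.
by move=> v u t /asboolP uv /asboolP vt; apply/asboolP; exact: congr_trans vt.
Qed.

Canonical cactus_equiv n := EquivRel (@cactus_rel n)
  (@cactus_rel_refl n) (@cactus_rel_sym n) (@cactus_rel_trans n).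

Definition cactus (n : nat) : Type := {eq_quot (@cactus_rel n)}%qT.

HB.instance Definition _ n := Choice.on (cactus n).
HB.instance Definition _ n := Quotient.on (cactus n).

Section CactusGroup.
Variable n : nat.
Implicit Types (u v : seq (interval n)) (x y z : cactus n).

Definition cword u : cactus n := (\pi_(cactus n) u)%qT.
Definition cgen (J : interval n) : cactus n := cword [:: J].

Lemma cword_eq u v : cword u = cword v <-> cactus_congr u v.
Proof.
split=> [/eqquotP/asboolP //|uv]; apply/eqquotP; exact/asboolP.
Qed.

Lemma cword_repr x : cword (generic_quotient.repr x) = x.
Proof. exact: reprK. Qed.

Lemma repr_cword u : cactus_congr (generic_quotient.repr (cword u)) u.
Proof. by apply/cword_eq; rewrite cword_repr. Qed.

Definition cactus_one : cactus n := cword [::].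
Definition cactus_mul x y : cactus n := cword (generic_quotient.repr x ++ generic_quotient.repr y).
Definition cactus_inv x : cactus n := cword (rev (generic_quotient.repr x)).

Lemma cactus_mulE u v : cactus_mul (cword u) (cword v) = cword (u ++ v).
Proof. by apply/cword_eq/congr_cat; exact: repr_cword. Qed.

Lemma cactus_mulA : associative cactus_mul.
Proof.
move=> x y z; rewrite -(cword_repr x) -(cword_repr y) -(cword_repr z).
by rewrite !cactus_mulE catA.
Qed.

Lemma cactus_mul1 : left_id cactus_one cactus_mul.
Proof. by move=> x; rewrite -(cword_repr x) cactus_mulE. Qed.

Lemma cactus_mulr1 : right_id cactus_one cactus_mul.
Proof. by move=> x; rewrite -(cword_repr x) cactus_mulE cats0. Qed.

Lemma congr_rev_cat u : cactus_congr (rev u ++ u) [::].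
Proof.
elim: u => [|J u IHu]; first exact: congr_refl.
rewrite rev_cons -cats1 -catA /= -[J :: J :: u]/([:: J; J] ++ u).
apply: congr_trans IHu; apply: congr_cat; first exact: congr_refl.
exact: (congr_cat (congr_invol J) (congr_refl u)).
Qed.

Lemma cactus_mulV : left_inverse cactus_one cactus_inv cactus_mul.
Proof.
move=> x; rewrite -{2}(cword_repr x) cactus_mulE; apply/cword_eq.
exact: congr_rev_cat.
Qed.

Lemma cactus_mulrV : right_inverse cactus_one cactus_inv cactus_mul.
Proof.
move=> x; rewrite -{1}(cword_repr x) cactus_mulE; apply/cword_eq.
by rewrite -{1}[generic_quotient.repr x]revK; exact: congr_rev_cat.
Qed.

End CactusGroup.

HB.instance Definition _ n := isGroup.Build (cactus n) (@cactus_mulA n)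
  (@cactus_mul1 n) (@cactus_mulr1 n) (@cactus_mulV n) (@cactus_mulrV n).

Lemma cwordM n (u v : seq (interval n)) :
  cword (u ++ v) = (cword u * cword v)%g.
Proof. by rewrite -cactus_mulE. Qed.

Lemma cgen_relations n : cactus_relations (@cgen n).
Proof.
split=> [J|J K dJK|J K L sKJ eL]; rewrite -!cwordM; apply/cword_eq.
- exact: congr_invol.
- exact: congr_disjoint.
- exact: congr_nested.
Qed.

Section CactusLift.
Variables (n : nat) (G : groupType) (f : interval n -> G).
Hypothesis fP : cactus_relations f.

Definition cactus_lift (x : cactus n) : G := (\prod_(J <- generic_quotient.repr x) f J)%g.

Lemma congr_prod u v : cactus_congr u v ->
  (\prod_(J <- u) f J = \prod_(J <- v) f J)%g.
Proof.
case: fP => fsq fdis fnest; elim=> {u v}.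
- by [].
- by move=> u v _ ->.
- by move=> u v t _ -> _ ->.
- by move=> u u' v v' _ Eu _ Ev; rewrite !big_cat /= Eu Ev.
- by move=> J; rewrite !big_cons big_nil mulg1 fsq.
- by move=> J K d; rewrite !big_cons big_nil !mulg1 fdis.
- by move=> J K L s e; rewrite !big_cons big_nil !mulg1 (fnest _ _ _ s e).
Qed.

Lemma cactus_lift_gen J : cactus_lift (cgen J) = f J.
Proof. by rewrite /cactus_lift (congr_prod (repr_cword _)) big_seq1. Qed.

Lemma cactus_lift_morphism : monoid.monoid_morphism cactus_lift.
Proof.
split; first by rewrite /cactus_lift (congr_prod (repr_cword _)) big_nil.
by move=> x y; rewrite /cactus_lift (congr_prod (repr_cword _)) big_cat.
Qed.

Definition cactus_hom : UMagmaMorphism.type (cactus n) G :=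
  HB.pack cactus_lift
    (isUMagmaMorphism.Build _ _ cactus_lift cactus_lift_morphism).

End CactusLift.

Definition pi_gen (n : nat) (J : interval n) : 'S_(n.-1) :=
  if (1 < hi J - lo J)%N then reversal n.-1 (lo J) (hi J).-1 else 1%g.

Lemma pi_genE n (J : interval n) (i : 'I_n.-1) :
  (pi_gen J i).+1 = reverse_in (lo J) (hi J).-1 i.+1.
Proof.
case: (intervalP J) => ? ? ?; rewrite /pi_gen; case: ifP => ?.
  by rewrite reversalE //; lia.
by rewrite perm1 /reverse_in; case: ifP; lia.
Qed.

Lemma wE n (J : interval n) (i : 'I_n) :
  (w J i).+1 = reverse_in (lo J) (hi J) i.+1.
Proof. by case: (intervalP J) => ? ? ?; rewrite reversalE. Qed.

Lemma interval_setP n (J : interval n) x : (lo J <= x <= hi J)%N ->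
  exists2 i : 'I_n, i.+1 = x & i \in interval_set J.
Proof.
case: (intervalP J) => ? ? ? Hx; have lt : (x.-1 < n)%N by lia.
by exists (Ordinal lt); rewrite ?inE /=; lia.
Qed.

Lemma subset_bounds n (J K : interval n) :
  interval_set K \subset interval_set J -> (lo J <= lo K)%N /\ (hi K <= hi J)%N.
Proof.
case: (intervalP K) => ? ? ? /subsetP sKJ.
have [|i ei /sKJ] := @interval_setP n K (lo K); first by lia.
have [|j ej /sKJ] := @interval_setP n K (hi K); first by lia.
by rewrite !inE; lia.
Qed.

Lemma image_bounds n (J K L : interval n) :
  interval_set K \subset interval_set J ->
  interval_set L = w J @: interval_set K ->
  (lo L = lo J + hi J - hi K)%N /\ (hi L = lo J + hi J - lo K)%N.
Proof.
move=> /subset_bounds[loJK hiKJ] eL.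
case: (intervalP K) (intervalP L) => ? ? ? [? ? ?].
have fwd x : (lo K <= x <= hi K)%N -> (lo L <= lo J + hi J - x <= hi L)%N.
  move=> Hx; have [i ei iK] := interval_setP Hx; have : w J i \in interval_set L.
    by rewrite eL imset_f.
  by rewrite inE wE /reverse_in ei; case: ifP => //; lia.
have bwd y : (lo L <= y <= hi L)%N ->
    exists2 x, (lo K <= x <= hi K)%N & (y = lo J + hi J - x)%N.
  move=> /interval_setP[j ej]; rewrite eL => /imsetP[i iK eji].
  move: iK; rewrite inE => iK; exists i.+1 => //.
  by rewrite -ej eji wE /reverse_in; case: ifP => //; lia.
have [|x1 ? ?] := bwd (lo L); first by lia.
have [|x2 ? ?] := bwd (hi L); first by lia.
have := fwd (lo K); have := fwd (hi K); lia.
Qed.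

Lemma disjoint_bounds n (J K : interval n) :
  [disjoint interval_set J & interval_set K] ->
  (hi J < lo K)%N || (hi K < lo J)%N.
Proof.
case: (intervalP J) (intervalP K) => ? ? ? [? ? ?] /pred0P djk.
apply: contraT; rewrite negb_or -!leqNgt => /andP[? ?].
have [|i ei iJ] := @interval_setP n J (maxn (lo J) (lo K)); first by lia.
by have := djk i; rewrite /= iJ inE /=; lia.
Qed.

Lemma reverse_inP a b x :
  ((a <= x)%N /\ (x <= b)%N /\ reverse_in a b x = (a + b - x)%N) \/
  (((x < a)%N \/ (b < x)%N) /\ reverse_in a b x = x).
Proof. by rewrite /reverse_in; case: ifP => ?; lia. Qed.

Local Ltac reverse_cases :=
  repeat match goal with |- context [reverse_in ?a ?b ?x] =>
    lazymatch x with context [reverse_in] => fail | _ =>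
      case: (reverse_inP a b x) => [[? [? ->]]|[? ->]] end end.

Lemma pi_gen_relations n : cactus_relations (@pi_gen n).
Proof.
split=> [J|J K /disjoint_bounds dJK|J K L sKJ eL]; apply/permP => i;
  rewrite ?permM ?perm1; apply: ord_inj; apply: succn_inj; rewrite !pi_genE.
- by case: (intervalP J) => ? ? ?; reverse_cases; lia.
- case: (intervalP J) (intervalP K) => ? ? ? [? ? ?].
  by reverse_cases; lia.
- have [-> ->] := image_bounds sKJ eL; have [? ?] := subset_bounds sKJ.
  case: (intervalP J) (intervalP K) => ? ? ? [? ? ?].
  by reverse_cases; lia.
Qed.

Definition cactus_pi (n : nat) : UMagmaMorphism.type (cactus n) 'S_(n.-1) :=
  cactus_hom (@pi_gen_relations n).

Lemma cactus_pi_cgen n (J : interval n) : cactus_pi n (cgen J) = pi_gen J.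
Proof. exact: (cactus_lift_gen (@pi_gen_relations n)). Qed.

Record rep (F : fieldType) (G : groupType) := Rep {
  rep_space :> vectType F;
  rep_act : G -> rep_space -> rep_space;
  rep_linear : forall g, linear (rep_act g);
  rep_act1 : forall v, rep_act 1%g v = v;
  rep_actM : forall g h v, rep_act (g * h)%g v = rep_act g (rep_act h v)
}.

HB.instance Definition _ (F : fieldType) (G : groupType) (V : rep F G) (g : G) :=
  GRing.isLinear.Build F V V *:%R (@rep_act F G V g) (rep_linear g).

Definition rep_iso (F : fieldType) (G : groupType) (V W : rep F G) : Prop :=
  exists2 f : {linear V -> W}, bijective f &
    forall g v, f (rep_act g v) = rep_act g (f v).

Section Operations.
Variables (F : fieldType) (G : groupType).

Definition rep_zero : rep F G.
Proof. by exists ('rV[F]_0 : vectType F) (fun _ v => v). Defined.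

Definition rep_dsum (V W : rep F G) : rep F G.
Proof.
exists ((V * W)%type : vectType F)
  (fun g v => (rep_act g v.1, rep_act g v.2)).
- by move=> g k u v /=; rewrite !rep_linear.
- by case=> u v /=; rewrite !rep_act1.
- by move=> g h [u v] /=; rewrite !rep_actM.
Defined.

Definition rep_copies (k : nat) (V : rep F G) : rep F G :=
  iter k (rep_dsum V) rep_zero.

Definition rep_pull (H : groupType) (f : UMagmaMorphism.type H G)
  (V : rep F G) : rep F H.
Proof.
exists (rep_space V) (fun h v => rep_act (f h) v).
- by move=> h; exact: rep_linear.
- by move=> v; rewrite gmulf1 rep_act1.
- by move=> g h v; rewrite gmulfM rep_actM.
Defined.

Definition subrep (V : rep F G) (U : {vspace V})
  (stU : forall g v, v \in U -> rep_act g v \in U) : rep F G.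
Proof.
exists (subvs_of U : vectType F) (fun g v => vsproj U (rep_act g (vsval v))).
- by move=> g k u v; rewrite (linearP (@vsval F V U)) rep_linear linearP.
- by move=> v; rewrite rep_act1 vsvalK.
- by move=> g h v; rewrite rep_actM vsprojK // stU // subvsP.
Defined.

End Operations.

Record gset (G : groupType) (X : Type) := GSet {
  gact :> G -> X -> X;
  gact1 : forall x, gact 1%g x = x;
  gactM : forall g h x, gact (g * h)%g x = gact g (gact h x)
}.

Section PermutationModule.
Variables (F : fieldType) (G : groupType) (X : finType) (rho : gset G X).

Definition basis_vector (x : X) : {ffun X -> F^o} := [ffun y => (y == x)%:R].

Definition perm_act (g : G) (v : {ffun X -> F^o}) : {ffun X -> F^o} :=
  [ffun x => v (rho g^-1%g x)].

Lemma perm_act_linear g : linear (perm_act g).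
Proof. by move=> k u v; apply/ffunP => x; rewrite !ffunE. Qed.

Lemma perm_act1 v : perm_act 1%g v = v.
Proof. by apply/ffunP => x; rewrite ffunE invg1 gact1. Qed.

Lemma perm_actM g h v : perm_act (g * h)%g v = perm_act g (perm_act h v).
Proof. by apply/ffunP => x; rewrite !ffunE invgM gactM. Qed.

Definition perm_rep : rep F G :=
  @Rep F G {ffun X -> F^o} perm_act perm_act_linear perm_act1 perm_actM.

Lemma perm_act_basis g x :
  perm_act g (basis_vector x) = basis_vector (rho g x).
Proof.
apply/ffunP => y; rewrite !ffunE; congr (_ %:R); congr nat_of_bool.
by apply/eqP/eqP => [<-|->]; rewrite -gactM ?mulgV ?mulVg gact1.
Qed.

End PermutationModule.

(* Shapes and contents are sequences of natural numbers, possibly with zeros;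
   rows and columns are numbered from 0. *)

Definition diagram (lam : seq nat) : seq (nat * nat) :=
  [seq (i, j) | i <- iota 0 (size lam), j <- iota 0 (nth 0%N lam i)].

Definition box (lam : seq nat) := seq_sub (diagram lam).

Definition row_of lam (x : box lam) : nat := (ssval x).1.
Definition col_of lam (x : box lam) : nat := (ssval x).2.

(* A partition of m has at most m nonzero parts, each at most m: it is
   represented by the weakly decreasing sequence of its parts, padded with
   zeros to length m. *)
Definition intpart (m : nat) :=
  {t : m.-tuple 'I_m.+1 |
    sorted geq [seq nat_of_ord k | k <- t] &&
    (sumn [seq nat_of_ord k | k <- t] == m)}.

Definition parts m (mu : intpart m) : seq nat :=
  [seq nat_of_ord k | k <- val mu].

Coercion parts : intpart >-> seq.

Definition hook (a b : nat) : seq nat := a :: nseq b 1%N.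

(* The entry k : 'I_(size nu) stands for k + 1. *)
Definition kostka (mu nu : seq nat) : nat :=
  #|[set T : {ffun box mu -> 'I_(size nu)} |
      [&& [forall x, forall y, (row_of x == row_of y) &&
             (col_of x < col_of y)%N ==> (T x <= T y)%N],
          [forall x, forall y, (col_of x == col_of y) &&
             (row_of x < row_of y)%N ==> (T x < T y)%N]
        & [forall k, #|[set x | T x == k]| == nth 0%N nu k]]]|.

Section Specht.
Variables (F : fieldType) (m : nat) (mu : seq nat).

Definition tableau := {ffun box mu -> 'I_m}.

(* The tabloid of a tableau is the sequence of the sets of entries of its
   rows. *)
Definition rowsets := {ffun 'I_(size mu) -> {set 'I_m}}.

Definition tabloid (t : tableau) : rowsets :=
  [ffun i : 'I_(size mu) => [set t x | x : box mu & row_of x == i]].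

(* Permutations compose from left to right here, (s * t) x = t (s x); a
   left action of 'S_m is therefore obtained by letting s move the entries
   through the permutation s^-1. *)
Definition move_rows (s : 'S_m) (r : rowsets) : rowsets :=
  [ffun i => s^-1%g @: r i].

Lemma move_rows1 r : move_rows 1 r = r.
Proof.
apply/ffunP => i; rewrite ffunE invg1 -[RHS]imset_id.
by apply: eq_imset => x; rewrite perm1.
Qed.

Lemma move_rowsM s t r : move_rows (s * t)%g r = move_rows s (move_rows t r).
Proof.
apply/ffunP => i; rewrite !ffunE -imset_comp invgM.
by apply: eq_imset => x; rewrite permM.
Qed.

Definition rows_gset : gset 'S_m rowsets :=
  @GSet 'S_m rowsets move_rows move_rows1 move_rowsM.

Definition move (s : 'S_m) (t : tableau) : tableau := [ffun x => s (t x)].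

Definition column_stab (t : tableau) : {set 'S_m} :=
  [set s : 'S_m | [forall x, exists y, (col_of y == col_of x) && (s (t x) == t y)]].

Definition polytabloid (t : tableau) : perm_rep F rows_gset :=
  \sum_(s in column_stab t) (-1) ^+ s *: basis_vector F (tabloid (move s t)).

(* For a partition mu of m the injective fillings are the bijective ones. *)
Definition specht_space : {vspace perm_rep F rows_gset} :=
  <<[seq polytabloid t | t <- enum [set t : tableau | injectiveb t]]>>%VS.

Lemma tabloid_move s t : move_rows s (tabloid t) = tabloid (move s^-1%g t).
Proof.
apply/ffunP => i; rewrite !ffunE -imset_comp.
by apply: eq_imset => x /=; rewrite ffunE.
Qed.

Lemma column_stabJ s t u :
  (s ^ u \in column_stab (move u t))%g = (s \in column_stab t).
Proof.
rewrite !inE; apply: eq_forallb => x; apply: eq_existsb => y.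
by rewrite !ffunE conjgE !permM permK (inj_eq perm_inj).
Qed.

Lemma act_polytabloid s t :
  rep_act s (polytabloid t) = polytabloid (move s^-1%g t).
Proof.
rewrite /polytabloid linear_sum [RHS](reindex_inj (conjg_inj s^-1%g)).
apply: eq_big => [u|u _]; first by rewrite column_stabJ.
rewrite linearZ /= perm_act_basis odd_permJ; congr (_ *: basis_vector _ _).
rewrite /= tabloid_move; congr tabloid; apply/ffunP => x.
by rewrite !ffunE conjgE !permM permK.
Qed.

Lemma specht_stable (s : 'S_m) (v : perm_rep F rows_gset) :
  v \in specht_space -> rep_act s v \in specht_space.
Proof.
have /subvP sub :
    (specht_space <= linfun (@rep_act _ _ _ s) @^-1: specht_space)%VS.
  apply/span_subvP => _ /mapP[t + ->]; rewrite mem_enum inE => /injectiveP t_inj.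
  rewrite -memv_preim lfunE [X in X \in _]act_polytabloid.
  apply: memv_span; apply: map_f; rewrite mem_enum inE.
  by apply/injectiveP => x y; rewrite !ffunE => /perm_inj/t_inj.
by move=> /sub; rewrite -memv_preim lfunE.
Qed.

Definition specht : rep F 'S_m := subrep specht_stable.

End Specht.

Definition standard lam (T : {ffun box lam -> 'I_(sumn lam).+1}) : bool :=
  [&& perm_eq [seq nat_of_ord (T x) | x : box lam] (iota 1 (sumn lam)),
      [forall x, forall y, (row_of x == row_of y) &&
         (col_of x < col_of y)%N ==> (T x < T y)%N]
    & [forall x, forall y, (col_of x == col_of y) &&
         (row_of x < row_of y)%N ==> (T x < T y)%N]].

Definition syt (lam : seq nat) :=
  {T : {ffun box lam -> 'I_(sumn lam).+1} | standard T}.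

Definition entry lam (T : syt lam) (x : box lam) : nat := val T x.

Section Schutzenberger.
Variable lam : seq nat.
Implicit Types (T : box lam -> nat) (x y : box lam) (k : nat).

Definition east x : option (box lam) := insub (row_of x, (col_of x).+1).
Definition south x : option (box lam) := insub ((row_of x).+1, col_of x).

(* Keeps a box only if it belongs to T|_[1,k]. *)
Definition within k T (o : option (box lam)) : option (box lam) :=
  obind (fun y => if (T y <= k)%N then Some y else None) o.

Definition slide_target k T x : option (box lam) :=
  match within k T (east x), within k T (south x) with
  | Some y, Some z => Some (if (T y < T z)%N then y else z)
  | Some y, None => Some y
  | None, o => o
  end.

(* The dummy box is at x; the result is the filling after the slides together
   with the final position of the dummy box (where the value of the filling is
   meaningless). *)
Fixpoint slide (fuel k : nat) T x : (box lam -> nat) * box lam :=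
  if fuel is fuel'.+1 then
    if slide_target k T x is Some y then
      slide fuel' k (fun z => if z == x then T y else T z) y
    else (T, x)
  else (T, x).

(* The dummy box visits every box at most once, so that #|box lam| slides are
   enough. *)
Definition promotion k T : box lam -> nat :=
  if [pick x | T x == 1%N] is Some x0 then
    let: (T', x) := slide #|{: box lam}| k T x0 in
    fun z => if z == x then k else if (T' z <= k)%N then (T' z).-1 else T' z
  else T.

(* xi_[1,k] is the composite of promotion 1, ..., promotion k, the last one
   being applied first. *)
Fixpoint xi1 k T : box lam -> nat :=
  if k is k'.+1 then xi1 k' (promotion k T) else T.

Definition xi n (J : interval n) T : box lam -> nat :=
  xi1 (hi J) (xi1 (hi J - lo J).+1 (xi1 (hi J) T)).

End Schutzenberger.

(* The Schützenberger module of lam is perm_rep of the C_n-set rho so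
   characterised: its basis vector b_T is basis_vector T (see perm_act_basis),
   and a C_n-action is determined by the action of the generators. *)
Definition schutzenberger_action n lam (rho : gset (cactus n) (syt lam)) :=
  forall (J : interval n) (T : syt lam),
    entry (rho (cgen J) T) =1 xi J (entry T).

(* Main.v *)
From HB Require Import structures.
Require Import Defs.
From mathcomp Require Import all_boot all_order all_algebra all_fingroup.
From mathcomp Require Import boolp reals complex zify.

(* A standard tableau of hook shape (a, 1^b) is determined by the b entries of
   its leg below the corner, a subset of {2, ..., n}.  Promotion of the part
   with entries at most k rotates {2, ..., k}, so that xi_[1,k] reverses
   {2, ..., k} and xi_[l,h] reverses {l + 1, ..., h}.  After a shift by one,
   this is the action of pi_{n-1} on b-subsets of {1, ..., n - 1}: the
   Schutzenberger module is the pullback of a permutation module on subsets,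
   and the theorem becomes Young's rule for two-part contents.

   For the latter, let M_k be the space of functions on k-subsets of a set of
   m >= 2k elements, viewed as square-free polynomials of degree k, and let U
   be the multiplication by the sum of all variables.  Then M_k is the direct
   sum of U M_{k-1} and the Specht module of (m - k, k), whose polytabloids are
   the products of k differences of distinct variables.  The sum is direct and
   U is injective on M_{k-1} because the adjoint D of U kills polytabloids while
   D U = U D + (m - 2j) on M_j is positive definite for j < k. *)

Set Implicit Arguments.
Unset Strict Implicit.
Unset Printing Implicit Defensive.

Import Order.TTheory GRing.Theory Num.Theory.

Local Open Scope ring_scope.

(** * Representations and their direct sums *)

(** Two choices shape the argument. The cactus relations are never checked on the involutions
    themselves: the action on hook tableaux is transported along [cactus_pi] from the action on
    subsets, and only its generators are compared with [xi]. And no dimension of a Specht module is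
    computed: that M_k is exhausted by U M_{k-1} and the polytabloids is shown by rewriting
    monomials directly. The injectivity of U needs m to be large compared with k, so Young's rule is
    proved for subsets of size min(a - 1, b), and a tableau is encoded by its leg or by its arm,
    whichever is shorter. Iterating the splitting down to degree 0 then gives the shapes (m - k, k)
    with k <= min(a - 1, b), once each; these are exactly the shapes whose Kostka number is nonzero,
    and that number is then 1. *)

Lemma inj_surj_bijective (S T : Type) (f : S -> T) :
  injective f -> (forall y, exists x, f x = y) -> bijective f.
Proof.
move=> f_inj f_surj; have [g gP] := boolp.choice f_surj.
by exists g => x //; apply: f_inj.
Qed.

Section RepIso.
Variables (F : fieldType) (G : groupType).
Implicit Types V W : rep F G.

Lemma rep_iso_refl V : rep_iso V V.
Proof. by exists idfun => //; exists idfun. Qed.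

Lemma rep_iso_sym V W : rep_iso V W -> rep_iso W V.
Proof.
case=> f f_bij fG; have [g fK gK] := f_bij.
have g_lin : linear g.
  by move=> k u v; apply: (can_inj fK); rewrite linearP !gK.
pose gl : {linear W -> V} := HB.pack g (GRing.isLinear.Build _ _ _ _ g g_lin).
by exists gl; [exists f | move=> h v; apply: (can_inj fK); rewrite fG !gK].
Qed.

Lemma rep_iso_trans W V Z : rep_iso V W -> rep_iso W Z -> rep_iso V Z.
Proof.
move=> [f f_bij fG] [g g_bij gG]; exists (g \o f); first exact: bij_comp.
by move=> h v /=; rewrite fG gG.
Qed.

Definition dsum_map V W V' W' (f : {linear V -> V'}) (g : {linear W -> W'})
  (x : rep_dsum V W) : rep_dsum V' W' := (f x.1, g x.2).

Lemma dsum_map_linear V W V' W' f g : linear (@dsum_map V W V' W' f g).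
Proof. by move=> k u v; rewrite /dsum_map /= !linearP. Qed.

Lemma rep_iso_dsum V W V' W' :
  rep_iso V V' -> rep_iso W W' -> rep_iso (rep_dsum V W) (rep_dsum V' W').
Proof.
move=> [f [f' fK f'K] fG] [g [g' gK g'K] gG].
pose h : {linear rep_dsum V W -> rep_dsum V' W'} := HB.pack (dsum_map f g)
  (GRing.isLinear.Build _ _ _ _ (dsum_map f g) (dsum_map_linear f g)).
exists h; last by move=> k [u v]; rewrite /= /dsum_map /= fG gG.
by exists (fun x : rep_dsum V' W' => (f' x.1, g' x.2)); case=> u v;
  rewrite /= /dsum_map /= ?fK ?f'K ?gK ?g'K.
Qed.

Definition dsum_swap V W Z (x : rep_dsum V (rep_dsum W Z)) :
  rep_dsum W (rep_dsum V Z) := (x.2.1, (x.1, x.2.2)).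

Lemma rep_iso_dsum_swap V W Z :
  rep_iso (rep_dsum V (rep_dsum W Z)) (rep_dsum W (rep_dsum V Z)).
Proof.
have h_lin : linear (@dsum_swap V W Z) by [].
pose h : {linear rep_dsum V (rep_dsum W Z) -> rep_dsum W (rep_dsum V Z)} :=
  HB.pack (@dsum_swap V W Z) (GRing.isLinear.Build _ _ _ _ _ h_lin).
by exists h => //; exists (@dsum_swap W V Z); case=> u [].
Qed.

Lemma rep_iso_dsum0 V : rep_iso (rep_dsum (rep_zero F G) V) V.
Proof.
have h_lin : linear (snd : rep_dsum (rep_zero F G) V -> V) by [].
pose h : {linear rep_dsum (rep_zero F G) V -> V} :=
  HB.pack (snd : rep_dsum (rep_zero F G) V -> V)
    (GRing.isLinear.Build _ _ _ _ _ h_lin).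
exists h => //; exists (fun v => (0, v)) => //.
by case=> u v /=; rewrite [u]thinmx0.
Qed.

Lemma rep_iso_dsumr0 V : rep_iso (rep_dsum V (rep_zero F G)) V.
Proof.
have h_lin : linear (fst : rep_dsum V (rep_zero F G) -> V) by [].
pose h : {linear rep_dsum V (rep_zero F G) -> V} :=
  HB.pack (fst : rep_dsum V (rep_zero F G) -> V)
    (GRing.isLinear.Build _ _ _ _ _ h_lin).
exists h => //; exists (fun v => (v, 0)) => //.
by case=> u v /=; rewrite [v]thinmx0.
Qed.

Section BigSum.
Variables (I : eqType) (V : I -> rep F G).
Implicit Types (r s : seq I).

Local Notation bigsum s := (\big[@rep_dsum F G/@rep_zero F G]_(i <- s) V i).

Lemma big_dsum_rem i s : i \in s ->
  rep_iso (bigsum s) (rep_dsum (V i) (bigsum (rem i s))).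
Proof.
elim: s => [//|j s IHs] /=; rewrite inE eq_sym big_cons.
have [->|neq_ij] /= := eqVneq j i; first by move=> _; exact: rep_iso_refl.
move=> /IHs iso_s; rewrite big_cons.
apply: rep_iso_trans (rep_iso_dsum_swap _ _ _).
exact: rep_iso_dsum (rep_iso_refl _) iso_s.
Qed.

(** [rep_dsum] is commutative and associative only up to isomorphism, so the summands are moved one
    at a time by [rep_iso_dsum_swap]. *)
Lemma perm_big_dsum r s : perm_eq r s -> rep_iso (bigsum r) (bigsum s).
Proof.
elim: r s => [|i r IHr] s rs.
  by have /perm_nilP-> : perm_eq s [::]; [rewrite perm_sym | exact: rep_iso_refl].
have i_s : i \in s by rewrite -(perm_mem rs) mem_head.
rewrite big_cons; apply: rep_iso_trans (rep_iso_sym (big_dsum_rem i_s)).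
apply: rep_iso_dsum (rep_iso_refl _) _; apply: IHr.
by rewrite -(perm_cons i); apply: perm_trans rs _; exact: perm_to_rem.
Qed.

Lemma big_copies (k : I -> nat) s : (forall i, k i <= 1)%N ->
  rep_iso (\big[@rep_dsum F G/@rep_zero F G]_(i <- s) rep_copies (k i) (V i))
          (bigsum [seq i <- s | k i == 1%N]).
Proof.
move=> k_le1; elim: s => [|i s IHs]; first by rewrite !big_nil; exact: rep_iso_refl.
rewrite big_cons /=; have := k_le1 i; case: (k i) => [|[|//]] _ /=.
  exact: rep_iso_trans (rep_iso_dsum0 _) IHs.
rewrite big_cons; apply: rep_iso_dsum IHs; exact: rep_iso_dsumr0.
Qed.

End BigSum.

Lemma rep_iso_subrep W V (U : {vspace V})
    (stU : forall g v, v \in U -> rep_act g v \in U) (f : {linear W -> V}) :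
  (forall g w, f (rep_act g w) = rep_act g (f w)) -> injective f ->
  (forall w, f w \in U) -> (forall u, u \in U -> exists w, f w = u) ->
  rep_iso W (subrep stU).
Proof.
move=> fG f_inj fU f_surj.
pose h0 (w : W) : subrep stU := vsproj U (f w).
have h_lin : linear h0 by move=> k u v; rewrite /h0 !linearP.
pose h : {linear W -> subrep stU} :=
  HB.pack h0 (GRing.isLinear.Build _ _ _ _ h0 h_lin).
exists h; last first.
  by move=> g w; rewrite /= /h0 fG vsprojK ?fU.
apply: inj_surj_bijective.
  by move=> u v /(congr1 vsval); rewrite /= /h0 !vsprojK ?fU //; exact: f_inj.
move=> u; have [w fw] := f_surj (vsval u) (subvsP u).
by exists w; rewrite /= /h0 fw vsvalK.
Qed.

End RepIso.

Section Pull.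
Variables (F : fieldType) (H G : groupType) (p : UMagmaMorphism.type H G).

Lemma rep_iso_pull (V W : rep F G) :
  rep_iso V W -> rep_iso (rep_pull p V) (rep_pull p W).
Proof. by case=> f f_bij fG; exists f => // h v; exact: fG. Qed.

Lemma rep_iso_pull_dsum (V W : rep F G) :
  rep_iso (rep_pull p (rep_dsum V W)) (rep_dsum (rep_pull p V) (rep_pull p W)).
Proof. by exists idfun => //; exists idfun. Qed.

Lemma rep_iso_pull_subrep (W : rep F H) (V : rep F G) (U : {vspace V})
    (stU : forall g v, v \in U -> rep_act g v \in U) (f : {linear W -> V}) :
  (forall g w, f (rep_act g w) = rep_act (p g) (f w)) -> injective f ->
  (forall w, f w \in U) -> (forall u, u \in U -> exists w, f w = u) ->
  rep_iso W (rep_pull p (subrep stU)).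
Proof.
move=> fG f_inj fU f_surj.
have stU' h (v : rep_pull p V) : v \in U -> rep_act h v \in U by exact: stU.
apply: (rep_iso_trans (@rep_iso_subrep _ _ W (rep_pull p V) U stU' f _ _ _ _)) => //.
by exists idfun => //; exists idfun.
Qed.

End Pull.

(** * Functions on the subsets of a finite set *)

Section SetFunctions.
Variables (F : numClosedFieldType) (T : finType).
Local Notation X := {ffun {set T} -> F^o}.
Implicit Types (i : T) (A B : {set T}) (u v : X) (ps : seq (T * T)).

(* A function on {set T} is read as a square-free polynomial with one variable
   per element of T: [mulv i] multiplies by the variable i, modulo its square. *)
Definition mulv i v : X := [ffun A : {set T} => if i \in A then v (A :\ i) else 0].

Definition raise v : X := \sum_i mulv i v.

(** On polynomials this is the sum of all partial derivatives; it is also the adjoint of [raise],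
    see [dot_raise]. *)
Definition lower v : X := [ffun A : {set T} => \sum_(i | i \notin A) v (i |: A)].

Fact mulv_linear i : linear (mulv i).
Proof.
move=> k u v; apply/ffunP => A; rewrite !ffunE.
by case: ifP => _; rewrite ?ffunE // scaler0 addr0.
Qed.
HB.instance Definition _ i :=
  GRing.isLinear.Build F X X *:%R (mulv i) (mulv_linear i).

Fact raise_linear : linear raise.
Proof.
move=> k u v; rewrite /raise scaler_sumr -big_split /=.
by apply: eq_bigr => i _; rewrite linearP.
Qed.
HB.instance Definition _ := GRing.isLinear.Build F X X *:%R raise raise_linear.

Fact lower_linear : linear lower.
Proof.
move=> k u v; apply/ffunP => A; rewrite !ffunE scaler_sumr -big_split /=.
by apply: eq_bigr => i _; rewrite !ffunE.
Qed.
HB.instance Definition _ := GRing.isLinear.Build F X X *:%R lower lower_linear.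

Lemma raiseE v A : raise v A = \sum_(i in A) v (A :\ i).
Proof.
rewrite /raise sum_ffunE [RHS]big_mkcond /=.
by apply: eq_bigr => i _; rewrite ffunE.
Qed.

(** The sl_2 relation. Adding i and removing a different j can be done in either order; only the
    terms where the same element is added and removed differ, and they number [#|~: A|] on one side
    and [#|A|] on the other. *)
Lemma lower_raise v A :
  lower (raise v) A + v A *+ #|A| = raise (lower v) A + v A *+ #|~: A|.
Proof.
rewrite raiseE !ffunE -!sumr_const.
under eq_bigr => i iA.
  rewrite raiseE (bigD1 i) ?setU11 //= setU1K //.
  over.
under [in RHS]eq_bigr => j jA.
  rewrite ffunE (bigD1 j) ?setD11 //= setD1K //.
  over.
rewrite !big_split /= addrAC [RHS]addrAC; congr (_ + _).
  by rewrite addrC; congr (_ + _); apply: eq_bigl => i; rewrite inE.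
rewrite (exchange_big_dep (mem A)) /=; last first.
  by move=> i j iA; rewrite !inE => /andP[/orP[/eqP->|]//]; rewrite eqxx.
apply: eq_bigr => j jA; apply: eq_big => i.
  rewrite !inE jA orbT andTb negb_and negbK.
  by have [->|] := eqVneq i j; rewrite ?jA //= orbF andbT.
case/andP=> iA _; congr (v _); apply/setP => l; rewrite !inE.
by have [->|//] := eqVneq l i; rewrite /= andbT; apply: contraNneq iA => ->.
Qed.

Definition dot u v : F := \sum_A u A * (v A)^*.

Lemma dot_raise u v : dot (raise u) v = dot u (lower v).
Proof.
rewrite /dot.
under eq_bigr => A _ do rewrite raiseE mulr_suml.
under [RHS]eq_bigr => A _ do rewrite ffunE rmorph_sum mulr_sumr /=.
rewrite (exchange_big_dep predT) //= [RHS](exchange_big_dep predT) //=.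
apply: eq_bigr => i _.
rewrite [RHS](reindex_onto (fun A => A :\ i) (fun A => i |: A)) /=; last first.
  by move=> A iA; rewrite setU1K.
apply: eq_big => A; last by move=> iA; rewrite setD1K.
rewrite !inE eqxx /=; apply/idP/eqP => [|<-]; first exact: setD1K.
by rewrite setU11.
Qed.

Lemma dot_ge0 v : 0 <= dot v v.
Proof. by apply: sumr_ge0 => A _; rewrite mul_conjC_ge0. Qed.

Lemma dot_eq0 v : dot v v = 0 -> v = 0.
Proof.
move=> /eqP; rewrite psumr_eq0 => [/allP v0|A _]; last by rewrite mul_conjC_ge0.
apply/ffunP => A; rewrite ffunE; apply/eqP.
by rewrite -mul_conjC_eq0; exact: v0 (mem_index_enum A).
Qed.

(* The offset lets [layer 0 = 0] serve as the layer below that of the empty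
   set. *)
Definition off_layer k v : X := [ffun A : {set T} => if #|A|.+1 == k then 0 else v A].

Fact off_layer_linear k : linear (off_layer k).
Proof.
move=> c u v; apply/ffunP => A; rewrite !ffunE.
by case: ifP => _; rewrite ?ffunE // scaler0 addr0.
Qed.
HB.instance Definition _ k :=
  GRing.isLinear.Build F X X *:%R (off_layer k) (off_layer_linear k).

Definition layer k : {vspace X} := lker (linfun (off_layer k)).

Lemma layerP k v : reflect (forall A, #|A|.+1 != k -> v A = 0) (v \in layer k).
Proof.
rewrite memv_ker lfunE; apply: (iffP eqP) => [/ffunP v0 A /negbTE Ak|v0].
  by have := v0 A; rewrite !ffunE Ak.
by apply/ffunP => A; rewrite !ffunE; case: eqP => // /eqP; exact: v0.
Qed.

Lemma layer0 v : v \in layer 0 -> v = 0.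
Proof. by move/layerP => v0; apply/ffunP => A; rewrite ffunE v0. Qed.

Lemma mulv_layer k i v : v \in layer k -> mulv i v \in layer k.+1.
Proof.
move/layerP => v0; apply/layerP => A Ak; rewrite ffunE; case: ifP => // iA.
by apply: v0; move: Ak; rewrite (cardsD1 i A) iA.
Qed.

Lemma raise_layer k v : v \in layer k -> raise v \in layer k.+1.
Proof. by move=> vk; apply: memv_suml => i _; exact: mulv_layer. Qed.

(* <v, lower (raise v)> = |lower v|^2 + (|T| - 2 (k - 1)) |v|^2 *)
Lemma lower_raise_inj k v : v \in layer k -> (k.*2 <= #|T|.+1)%N ->
  lower (raise v) = 0 -> v = 0.
Proof.
case: k => [/layer0 //|k] /layerP v0 k2 lr0; apply: dot_eq0.
have eq_dot : dot v v *+ k = dot (lower v) (lower v) + dot v v *+ (#|T| - k).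
  rewrite -dot_raise /dot -!sumrMnl -big_split /=; apply: eq_bigr => A _.
  have [[Ak]|/v0->] := eqVneq #|A|.+1 k.+1; last first.
    by rewrite conjC0 !mulr0 !mul0rn addr0.
  have := lower_raise v A; rewrite lr0 ffunE add0r Ak.
  have -> : #|~: A| = (#|T| - k)%N by rewrite -(cardsC A) Ak addKn.
  by move=> eqA; rewrite -!mulrnAl eqA mulrDl.
(* The layer [k.+1] holds the k-subsets, so the hypothesis amounts to [2 * k < #|T|], and the
   coefficient of |v|^2 is positive. *)
have k_lt : (k < #|T| - k)%N by lia.
have : dot (lower v) (lower v) + dot v v *+ (#|T| - k - k) = 0.
  by rewrite mulrnBr ?(ltnW k_lt) // addrA -eq_dot subrr.
move/eqP; rewrite paddr_eq0 ?mulrn_wge0 ?dot_ge0 // => /andP[_].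
by rewrite mulrn_eq0 subn_eq0 leqNgt k_lt /= => /eqP.
Qed.

(** * Functions antisymmetric under the swaps of disjoint pairs *)

Definition antisym ps v :=
  forall p, p \in ps -> forall A, v (tperm p.1 p.2 @: A) = - v A.

Definition flat ps : seq T := flatten [seq [:: p.1; p.2] | p <- ps].

Lemma perm_flat ps : perm_eq (flat ps) (unzip1 ps ++ unzip2 ps).
Proof.
elim: ps => //= p ps IHps; rewrite /flat /= perm_cons perm_sym.
by rewrite (perm_catCA (unzip1 ps) [:: p.2]) /= perm_cons perm_sym.
Qed.

Lemma fst_notin_snd ps p : uniq (flat ps) -> p \in ps -> p.1 \notin unzip2 ps.
Proof.
rewrite (perm_uniq (perm_flat ps)) cat_uniq => /and3P[_ /hasPn ps12 _] p_ps.
by apply: contraL (map_f fst p_ps) => /ps12.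
Qed.

Lemma uniq_snd ps : uniq (flat ps) -> uniq (unzip2 ps).
Proof. by rewrite (perm_uniq (perm_flat ps)) cat_uniq => /and3P[]. Qed.

Lemma tperm_imset_id i j A : (i \in A) = (j \in A) -> tperm i j @: A = A.
Proof.
move=> ij; have sub : tperm i j @: A \subset A.
  apply/subsetP => _ /imsetP[l lA ->].
  by case: tpermP => [eq_l|eq_l|//]; [rewrite -ij -eq_l | rewrite ij -eq_l].
by apply/eqP; rewrite eqEcard sub (card_imset _ perm_inj) leqnn.
Qed.

(** The swap fixes such a set, so that [v A = - v A]. *)
Lemma antisym_fix ps v p A : antisym ps v -> p \in ps ->
  (p.1 \in A) = (p.2 \in A) -> v A = 0.
Proof.
move=> anti p_ps pA; have := anti _ p_ps A; rewrite tperm_imset_id // => /eqP.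
by rewrite -addr_eq0 -mulr2n mulrn_eq0 /= => /eqP.
Qed.

Definition choices ps A : seq T := [seq if p.1 \in A then p.1 else p.2 | p <- ps].

Lemma subseq_choices ps A : subseq (choices ps A) (flat ps).
Proof.
elim: ps => // p ps IHps; apply: (@cat_subseq _ [:: _] _ [:: p.1; p.2]) IHps; rewrite sub1seq !inE.
by case: ifP; rewrite eqxx ?orbT.
Qed.

Lemma transversal_choices ps A :
  (forall p, p \in ps -> (p.1 \in A) != (p.2 \in A)) ->
  {subset choices ps A <= A}.
Proof.
move=> psA _ /mapP[p /psA pA ->]; move: pA.
by case: ifP => //; case: (p.2 \in A).
Qed.

Lemma transversal_card ps A : uniq (flat ps) ->
  (forall p, p \in ps -> (p.1 \in A) != (p.2 \in A)) -> (size ps <= #|A|)%N.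
Proof.
move=> ps_uniq psA; rewrite cardE -(size_map (fun p => if p.1 \in A then p.1 else p.2)).
apply: uniq_leq_size; first exact: subseq_uniq (subseq_choices ps A) ps_uniq.
by move=> i /(transversal_choices psA); rewrite mem_enum.
Qed.

Lemma antisym_small ps v A : uniq (flat ps) -> antisym ps v ->
  (#|A| < size ps)%N -> v A = 0.
Proof.
move=> ps_uniq anti A_lt.
have [/allP psA|/allPn[p p_ps]] :=
    boolP (all (fun p => (p.1 \in A) != (p.2 \in A)) ps).
  by have := transversal_card ps_uniq psA; rewrite leqNgt A_lt.
by rewrite negbK => /eqP; exact: antisym_fix anti p_ps.
Qed.

Lemma antisym_lower ps v : antisym ps v -> antisym ps (lower v).
Proof.
move=> anti p p_ps A; rewrite !ffunE -sumrN.
set s := tperm p.1 p.2; rewrite (reindex_inj (@perm_inj _ s)) /=.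
apply: eq_big => [i|i _]; first by rewrite (mem_imset _ _ perm_inj).
by rewrite -(anti _ p_ps) imsetU1.
Qed.

(** A set of k points is either fixed by one of the k swaps, where v vanishes, or a transversal of
    the pairs, and the swaps connect all transversals. This identifies a polytabloid without
    expanding its signed sum. *)
Lemma antisym_determined ps v : uniq (flat ps) -> antisym ps v ->
  v \in layer (size ps).+1 -> v [set i in unzip2 ps] = 0 -> v = 0.
Proof.
move=> ps_uniq anti /layerP v_layer vB; set B := [set i in _] in vB.
apply/ffunP => A; rewrite ffunE; have [d] := ubnP #|A :\: B|.
elim: d A => // d IHd A; rewrite ltnS => A_le.
have [[Ak]|/v_layer //] := eqVneq #|A|.+1 (size ps).+1.
have [/allP psA|/allPn[p p_ps]] :=
    boolP (all (fun p => (p.1 \in A) != (p.2 \in A)) ps); last first.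
  by rewrite negbK => /eqP; exact: antisym_fix anti p_ps.
(* Swapping a first point of A for its partner, which lies in B, lowers [#|A :\: B|]. If A has no
   first point, it contains every second point and equals B by cardinality. *)
have [/hasP[p p_ps pA]|/hasPn noA] := boolP (has (fun p => p.1 \in A) ps).
  have pB : p.1 \notin B.
    by rewrite inE fst_notin_snd.
  apply/eqP; rewrite -oppr_eq0 -(anti _ p_ps); apply/eqP/IHd.
  apply: leq_trans A_le; apply: proper_card; apply/properP; split.
    apply/subsetP => i /setDP[/imsetP[j jA ->]].
    case: tpermP => [_|_|_ _ jB]; last by rewrite inE jB.
      by rewrite inE map_f.
    by rewrite in_setD pA pB.
  exists p.1; first by rewrite inE pB.
  rewrite inE negb_and negbK; apply/orP; right; apply/imsetP => -[j jA eq_p].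
  have := psA p p_ps; rewrite pA; move: eq_p.
  by case: tpermP => [_ <-|<-|neq _ /esym//]; rewrite ?pA ?jA.
suff -> : A = B by [].
apply/esym/eqP; rewrite eqEcard; apply/andP; split.
  apply/subsetP => i; rewrite inE => /mapP[p p_ps ->].
  by have := psA p p_ps; rewrite (negbTE (noA _ p_ps)); case: (_ \in A).
move: Ak => [->]; by rewrite cardsE (card_uniqP _) ?size_map ?uniq_snd.
Qed.

Lemma flat_rem ps p (p_ps : p \in ps) : perm_eq (flat ps) [:: p.1, p.2 & flat (rem p ps)].
Proof.
exact: perm_flatten (perm_map _ (perm_to_rem p_ps)).
Qed.

Lemma mem_flat ps p : p \in ps -> (p.1 \in flat ps) && (p.2 \in flat ps).
Proof. by move=> p_ps; rewrite !(perm_mem (flat_rem p_ps)) !inE !eqxx orbT. Qed.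

(** * Products of differences of variables *)

Lemma mulvC i j v : mulv i (mulv j v) = mulv j (mulv i v).
Proof.
apply/ffunP => A; rewrite !ffunE !inE setDDl setUC -setDDl.
have [->//|_] := eqVneq i j; rewrite /=.
by case: (i \in A); case: (j \in A).
Qed.

Lemma mulvv i v : mulv i (mulv i v) = 0.
Proof. by apply/ffunP => A; rewrite !ffunE !inE eqxx; case: ifP. Qed.

Definition mulvs s v : X := foldr mulv v s.

Lemma mulv_mulvs i s v : mulv i (mulvs s v) = mulvs s (mulv i v).
Proof. by elim: s => //= j s IHs; rewrite mulvC IHs. Qed.

Fact mulvs_linear s : linear (mulvs s).
Proof. by move=> k u v; elim: s => //= i s ->; rewrite linearP. Qed.
HB.instance Definition _ s :=
  GRing.isLinear.Build F X X *:%R (mulvs s) (mulvs_linear s).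

Lemma mulvs_layer k s v : v \in layer k -> mulvs s v \in layer (size s + k).
Proof. by move=> vk; elim: s => //= i s; exact: mulv_layer. Qed.

Lemma mulvs_rem i s v : i \in s -> mulv i (mulvs (rem i s) v) = mulvs s v.
Proof.
elim: s => //= j s IHs; rewrite inE eq_sym.
by have [->//|_ /= /IHs <-] := eqVneq j i; rewrite mulvC.
Qed.

(** The product of the differences x_(p.2) - x_(p.1), built from the constant 1, which is
    [basis_vector F set0]. With this sign the coefficient at the set of second points is 1, as for a
    polytabloid at its second row. *)
Definition pairprod ps : X :=
  foldr (fun p v => mulv p.2 v - mulv p.1 v) (basis_vector F set0) ps.

(** Modulo squares, (x + y)(y - x) = 0. *)
Lemma mulv_pairprod ps p : p \in ps ->
  mulv p.1 (pairprod ps) + mulv p.2 (pairprod ps) = 0.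
Proof.
elim: ps => //= q ps IHps; rewrite inE !linearB => /predU1P[->|/IHps ps0].
  by rewrite /= !mulvv subr0 sub0r (mulvC q.1) subrr.
rewrite addrACA -opprD /= !(mulvC _ q.2) !(mulvC _ q.1) -!linearD ps0.
by rewrite !linear0 addr0.
Qed.

(** The product of differences of indicators does not see points outside the pairs; the cardinality
    factor discards the sets that have such points besides one point of each pair. *)
Lemma pairprodE ps A : uniq (flat ps) ->
  pairprod ps A =
    (\prod_(p <- ps) ((p.2 \in A)%:R - (p.1 \in A)%:R)) * (#|A| == size ps)%:R.
Proof.
elim: ps A => [|p ps IHps] A; first by rewrite ffunE big_nil mul1r cards_eq0.
rewrite {1}/flat /= !inE negb_or => /and3P[/andP[p12 p1] p2 ps_uniq].
have step i : i \notin flat ps -> mulv i (pairprod ps) A = (i \in A)%:R *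
    ((\prod_(p <- ps) ((p.2 \in A)%:R - (p.1 \in A)%:R)) * (#|A| == (size ps).+1)%:R).
  move=> i_ps; rewrite ffunE; case: ifP => iA; last by rewrite mul0r.
  rewrite mul1r IHps // (cardsD1 i A) iA; congr (_ * _).
  apply: eq_big_seq => q /mem_flat/andP[q1 q2]; rewrite !inE.
  by rewrite (memPn i_ps _ q1) (memPn i_ps _ q2).
have -> : pairprod (p :: ps) A = mulv p.2 (pairprod ps) A - mulv p.1 (pairprod ps) A.
  by rewrite /= !ffunE.
by rewrite !step // big_cons -mulrBl mulrA.
Qed.

Lemma pairprod_layer ps : uniq (flat ps) -> pairprod ps \in layer (size ps).+1.
Proof.
by move=> ps_uniq; apply/layerP => A; rewrite eqSS pairprodE // => /negbTE->;
  rewrite mulr0.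
Qed.

Lemma pairprod1 ps : uniq (flat ps) -> pairprod ps [set i in unzip2 ps] = 1.
Proof.
move=> ps_uniq; rewrite pairprodE // cardsE (card_uniqP (uniq_snd ps_uniq)).
rewrite size_map eqxx mulr1; apply: big1_seq => p /= p_ps.
by rewrite !inE map_f // (negbTE (fst_notin_snd ps_uniq p_ps)) subr0.
Qed.

Lemma antisym_pairprod ps : uniq (flat ps) -> antisym ps (pairprod ps).
Proof.
move=> ps_uniq p p_ps A; rewrite !pairprodE // (card_imset _ perm_inj) -mulNr.
congr (_ * _); rewrite !(perm_big _ (perm_to_rem p_ps)) !big_cons -mulNr opprB.
have in_img i : (i \in tperm p.1 p.2 @: A) = (tperm p.1 p.2 i \in A).
  by rewrite -{1}(tpermK p.1 p.2 i) (mem_imset _ _ perm_inj).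
rewrite !in_img tpermL tpermR; congr (_ * _).
move: ps_uniq; rewrite (perm_uniq (flat_rem p_ps)) /= inE negb_or.
case/and3P=> /andP[_ p1] p2 _; apply: eq_big_seq => q /mem_flat/andP[q1 q2].
by rewrite !in_img !tpermD // eq_sym ((memPn p1), (memPn p2)).
Qed.

Lemma basis_mulvs A : basis_vector F A = mulvs (enum A) (basis_vector F set0).
Proof.
rewrite -{1}(set_enum A); elim: (enum A) (enum_uniq A) => [|i s IHs] /=.
  by move=> _; congr basis_vector; apply/setP => j; rewrite !inE.
case/andP=> i_s /IHs <-; rewrite set_cons; apply/ffunP => B; rewrite !ffunE.
case: ifP => iB; last by case: eqP iB => // ->; rewrite setU11.
congr (_ %:R); congr nat_of_bool; apply/eqP/eqP => [->|<-]; last by rewrite setD1K.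
by rewrite setU1K // inE.
Qed.

(* Multiplying P = [pairprod ps] by the sum of all variables only leaves the
   variables outside ps, so that modulo [raise] a further variable c of a
   monomial can be traded for the factors (c - d) with d unused. *)
Lemma layer_span (U : {vspace X}) k :
  (forall ps, size ps = k -> uniq (flat ps) -> pairprod ps \in U) ->
  (forall v, v \in layer k -> raise v \in U) ->
  forall v, v \in layer k.+1 -> v \in U.
Proof.
move=> prodU raiseU.
(* Mixed products of a monomial s with a [pairprod] interpolate between monomials and products of
   differences; the induction empties s. *)
have mulvsU s ps : (size s + size ps)%N = k -> uniq (s ++ flat ps) ->
    mulvs s (pairprod ps) \in U.
  elim: s ps => [|c s IHs] ps /=; first exact: prodU.
  move=> size_k /andP[c_sps sps_uniq]; set Q := mulvs s (pairprod ps).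
  have Q_layer : Q \in layer k.
    rewrite -size_k addSn -addnS; apply/mulvs_layer/pairprod_layer.
    by move: sps_uniq; rewrite cat_uniq => /and3P[].
  (* A variable of s kills Q by squaring, and the two variables of a pair cancel by [mulv_pairprod];
     hence [raise Q] only involves free variables. *)
  have Q0 : \sum_(d <- s ++ flat ps) mulv d Q = 0.
    rewrite big_cat big_flatten big_map /= !big1_seq ?addr0 // => [p|d] /=.
      move/mulv_pairprod => p0.
      by rewrite big_cons big_seq1 !mulv_mulvs -linearD p0 linear0.
    by move=> d_s; rewrite /Q -(mulvs_rem _ d_s) /= mulvv.
  pose free := [set d | d \notin s ++ flat ps].
  have free_sum : \sum_(d in free) mulv d Q = raise Q.
    rewrite /raise [RHS](bigID (mem free)) /= [X in _ = _ + X](_ : _ = 0) ?addr0 //.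
    by apply: etrans Q0; rewrite (big_uniq _ sps_uniq) /=; apply: eq_bigl => d; rewrite inE negbK.
  have c_free : c \in free by rewrite inE.
  have free_gt0 : (0 < #|free|)%N by apply/card_gt0P; exists c.
  (* This multiple of x_c Q is [raise Q] plus the sum of (x_c - x_d) Q over the free d; dividing by
     [#|free|] is possible because c itself is free. *)
  suff : mulv c Q *+ #|free| \in U.
    rewrite -scaler_nat => /(memvZ #|free|%:R^-1).
    by rewrite scalerA mulVf ?scale1r // pnatr_eq0 -lt0n.
  rewrite -sumr_const -[X in X \in U](subrK (raise Q)) -{1}free_sum -sumrB.
  apply: memvD (raiseU _ Q_layer); apply: memv_suml => d d_free.
  have [->|neq_dc] := eqVneq d c; first by rewrite subrr mem0v.
  rewrite !mulv_mulvs -linearB -[_ - _]/(pairprod ((d, c) :: ps)).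
  apply: IHs; first by rewrite /= addnS -size_k.
  rewrite /flat /= (uniq_catCA s [:: d; c]) /= inE negb_or neq_dc c_sps sps_uniq.
  by rewrite inE in d_free; rewrite d_free.
move=> v /layerP v0.
have -> : v = \sum_A v A *: basis_vector F A.
  apply/ffunP => B; rewrite sum_ffunE (bigD1 B) //= big1 => [|A neq_AB].
    by rewrite !ffunE eqxx addr0 [RHS]mulr1.
  by rewrite !ffunE eq_sym (negbTE neq_AB) [LHS]mulr0.
apply: memv_suml => A _; have [[Ak]|/v0->] := eqVneq #|A|.+1 k.+1; last first.
  by rewrite scale0r mem0v.
rewrite basis_mulvs; apply/memvZ/(mulvsU _ [::]); first by rewrite addn0 -cardE.
by rewrite cats0 enum_uniq.
Qed.
End SetFunctions.

(** * Specht modules of two-row partitions *)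

Lemma mem_diagram lam i j : ((i, j) \in diagram lam) = (j < nth 0%N lam i)%N.
Proof.
apply/allpairsPdep/idP => [[i' [j' [_ + [-> ->]]]]|j_lt].
  by rewrite mem_iota add0n.
exists i, j; split=> //; rewrite mem_iota add0n //= ltnNge.
by apply: contraL j_lt => ?; rewrite nth_default.
Qed.

Lemma diagram_uniq lam : uniq (diagram lam).
Proof.
apply: allpairs_uniq_dep; first exact: iota_uniq.
  by move=> i _; exact: iota_uniq.
by move=> [i j] [i' j'] _ _ [-> ->].
Qed.

Lemma card_box lam : #|{: box lam}| = sumn lam.
Proof.
rewrite card_seq_sub ?diagram_uniq // size_allpairs_dep; congr sumn.
by under eq_map => i do rewrite size_iota; rewrite map_nth_iota0 ?take_size.
Qed.

Lemma box_inj lam (x y : box lam) :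
  row_of x = row_of y -> col_of x = col_of y -> x = y.
Proof.
rewrite /row_of /col_of => eq1 eq2; apply: val_inj.
by rewrite /= (surjective_pairing (ssval x)) eq1 eq2 -surjective_pairing.
Qed.

Lemma col_lt lam (x : box lam) : (col_of x < nth 0%N lam (row_of x))%N.
Proof. by rewrite -mem_diagram -surjective_pairing (ssvalP x). Qed.

Lemma box_at lam i j : (j < nth 0%N lam i)%N ->
  exists2 x : box lam, row_of x = i & col_of x = j.
Proof. by rewrite -mem_diagram => ij; exists (SeqSub ij). Qed.

Lemma sumn_nth0 s : (forall i, nth 0%N s i = 0%N) -> sumn s = 0%N.
Proof.
elim: s => //= x s IHs s0; rewrite (s0 0%N : x = 0%N) IHs // => i.
exact: (s0 i.+1).
Qed.

Section SetAction.
Variable m : nat.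

(** The inverse makes this a left action, in accordance with [move_rows]. *)
Definition move_set (s : 'S_m) (A : {set 'I_m}) : {set 'I_m} := s^-1%g @: A.

Lemma move_set1 A : move_set 1 A = A.
Proof.
rewrite /move_set invg1 -[RHS]imset_id.
by apply: eq_imset => x; rewrite perm1.
Qed.

Lemma move_setM s t A : move_set (s * t)%g A = move_set s (move_set t A).
Proof.
rewrite /move_set -imset_comp invgM.
by apply: eq_imset => x; rewrite permM.
Qed.

Definition set_gset : gset 'S_m {set 'I_m} :=
  @GSet 'S_m {set 'I_m} move_set move_set1 move_setM.

Lemma card_move_set s A : #|move_set s A| = #|A|.
Proof. exact/card_imset/perm_inj. Qed.

Variable F : numClosedFieldType.
Local Notation X := (perm_rep F set_gset).

Lemma layer_stable k (s : 'S_m) (v : X) :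
  v \in layer F _ k -> rep_act s v \in layer F _ k.
Proof.
move/layerP => v0; apply/layerP => A Ak; rewrite ffunE; apply: v0.
by rewrite [#|_|]card_move_set.
Qed.

Definition layer_rep k : rep F 'S_m := subrep (@layer_stable k).

Lemma raise_act (s : 'S_m) (v : X) : raise (rep_act s v : X) = rep_act s (raise v : X).
Proof.
apply/ffunP => A; rewrite [RHS]ffunE !raiseE [RHS](reindex_inj (@perm_inj _ s)) /=.
rewrite /move_set invgK; apply: eq_big => i; first by rewrite (mem_imset _ _ perm_inj).
rewrite ffunE /= /move_set invgK => _; congr (v _).
apply/setP => j; rewrite -[j](permKV s) in_setD1 !(mem_imset _ _ perm_inj).
by rewrite in_setD1 (inj_eq perm_inj).
Qed.

End SetAction.

(** The shape (m - k, k) read through [nth], hence insensitive to padding by zeros. *)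
Definition two_row m k (mu : seq nat) : Prop :=
  [/\ (0 < size mu)%N, nth 0%N mu 0 = (m - k)%N, nth 0%N mu 1 = k,
      forall i, nth 0%N mu i.+2 = 0%N & (k.*2 <= m)%N].

Section TwoRowSpecht.
Variables (F : numClosedFieldType) (m k : nat) (mu : seq nat).
Hypothesis mu2 : two_row m k mu.
Local Notation X := (perm_rep F (set_gset m)).
Local Notation Y := (perm_rep F (rows_gset m mu)).

Lemma sumn_two_row : sumn mu = m.
Proof.
case: mu2 => size_mu mu0 mu1 muS k2.
case: mu size_mu mu0 mu1 muS => [//|x [|y s]] _ /= mu0 mu1 muS; first by lia.
by have := sumn_nth0 muS; lia.
Qed.

Lemma row_lt2 (x : box mu) : (row_of x < 2)%N.
Proof.
case: mu2 => _ _ _ muS _; have := col_lt x.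
by case: (row_of x) => [|[|i]] //; rewrite muS.
Qed.

Definition rows_of (B : {set 'I_m}) : rowsets m mu :=
  [ffun i : 'I_(size mu) =>
    if i == 0%N :> nat then ~: B else if i == 1%N :> nat then B else set0].

Lemma rows_of_inj : injective rows_of.
Proof.
(* B is recovered from row 0, since row 1 may be missing from [mu] when k = 0. *)
case: mu2 => size_mu _ _ _ _ B C /ffunP/(_ (Ordinal size_mu)).
by rewrite !ffunE /= => /setC_inj.
Qed.

Lemma move_rows_of s B : move_rows s (rows_of B) = rows_of (move_set s B).
Proof.
apply/ffunP => i; rewrite !ffunE; case: eqP => _; last first.
  by case: eqP => _ //; rewrite imset0.
apply/setP => j; rewrite -[j](permKV s^-1%g) in_setC !(mem_imset _ _ perm_inj).
by rewrite in_setC.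
Qed.

Definition to_sets (v : Y) : X := [ffun B => v (rows_of B)].

Fact to_sets_linear : linear to_sets.
Proof. by move=> c u v; apply/ffunP => B; rewrite !ffunE. Qed.
HB.instance Definition _ := GRing.isLinear.Build F Y X *:%R to_sets to_sets_linear.

Lemma to_sets_act (s : 'S_m) (v : Y) : to_sets (rep_act s v) = rep_act s (to_sets v).
Proof. by apply/ffunP => B; rewrite !ffunE /= move_rows_of. Qed.

Section Tableau.
Variable t : tableau m mu.
Hypothesis t_inj : injective t.

Lemma tableau_surj i : exists x, t x = i.
Proof.
have : i \in codom t; last by case/codomP => x ->; exists x.
by apply: inj_card_onto t_inj _ i; rewrite card_box sumn_two_row card_ord.
Qed.

Definition second_row : {set 'I_m} := [set t x | x : box mu & row_of x == 1%N].

Lemma mem_second_row x : (t x \in second_row) = (row_of x == 1%N).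
Proof. by rewrite (mem_imset _ _ t_inj) inE. Qed.

Lemma tabloid_second_row s : tabloid (move s t) = rows_of (s @: second_row).
Proof.
have row1 : [set move s t x | x : box mu & row_of x == 1%N] = s @: second_row.
  by rewrite -imset_comp; apply: eq_imset => x; rewrite ffunE.
apply/ffunP => i; rewrite !ffunE.
case: eqP => i0.
  rewrite i0; apply/setP => j; rewrite -[j](permKV s) inE (mem_imset _ _ perm_inj).
  have [x <-] := tableau_surj (s^-1%g j).
  have -> : s (t x) = move s t x by rewrite ffunE.
  rewrite mem_imset ?mem_second_row ?inE; last first.
    by move=> y z; rewrite !ffunE => /perm_inj/t_inj.
  by have := row_lt2 x; case: (row_of x) => [|[|]].
case: eqP => i1; first by rewrite i1 row1.
apply/setP => j; rewrite inE; apply/imsetP => -[x]; rewrite inE => /eqP xi _.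
by have := row_lt2 x; rewrite xi; case: (val i) i0 i1 => [|[|]].
Qed.

Lemma to_sets_polytabloidE B : to_sets (polytabloid F t) B =
  \sum_(s in column_stab t) (-1) ^+ s * (s @: second_row == B)%:R.
Proof.
rewrite ffunE sum_ffunE; apply: eq_bigr => s _.
by rewrite !ffunE tabloid_second_row (inj_eq rows_of_inj) eq_sym.
Qed.

(** A column permutation that preserves the second row preserves both rows, hence every box, so only
    the identity contributes. *)
Lemma to_sets_polytabloid_second_row : to_sets (polytabloid F t) second_row = 1.
Proof.
have one_stab : 1%g \in column_stab t.
  by rewrite inE; apply/forallP => x; apply/existsP; exists x; rewrite perm1 !eqxx.
rewrite to_sets_polytabloidE (bigD1 1%g) //= [X in _ + X]big1 => [|s].
  by rewrite odd_perm1 expr0 mul1r addr0 (_ : _ @: _ = second_row) ?eqxx //;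
    rewrite -[RHS]imset_id; apply: eq_imset => x; rewrite perm1.
case/andP=> s_stab s_neq1; case: eqP => [sB|]; last by rewrite mulr0.
case/eqP: s_neq1; apply/permP => i; rewrite perm1; have [x <-] := tableau_surj i.
move: s_stab; rewrite inE => /forallP/(_ x)/existsP[y /andP[/eqP col_yx /eqP sx]].
rewrite sx; congr (t _); apply: box_inj col_yx.
have : (s (t x) \in s @: second_row) = (t x \in second_row).
  exact: mem_imset perm_inj.
rewrite sx sB !mem_second_row; have := row_lt2 x; have := row_lt2 y.
by case: (row_of x) (row_of y) => [|[|]] // [|[|]].
Qed.

(** The top entry comes first, so that the second row is the set of second points. *)
Definition columns (ps : seq ('I_m * 'I_m)) : Prop :=
  size ps = k /\ forall p, p \in ps -> exists x y : box mu,
    [/\ row_of x = 0%N, row_of y = 1%N, col_of x = col_of y & p = (t x, t y)].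

Lemma columns_second_row ps : columns ps -> uniq (flat ps) ->
  second_row = [set i in unzip2 ps].
Proof.
case=> size_ps psP ps_uniq; apply/eqP; rewrite eq_sym eqEcard; apply/andP; split.
  apply/subsetP => i; rewrite inE => /mapP[p /psP[x [y [_ y1 _ ->]]] ->].
  by rewrite mem_second_row y1.
rewrite cardsE (card_uniqP (uniq_snd ps_uniq)) size_map size_ps.
rewrite (card_imset _ t_inj) cardE -(size_map (@col_of mu)) -(size_iota 0 k).
apply: uniq_leq_size => [|j].
  rewrite map_inj_in_uniq ?enum_uniq // => x y; rewrite !mem_enum !inE.
  by move=> /eqP x1 /eqP y1; apply: box_inj; rewrite x1 y1.
case/mapP=> x; rewrite mem_enum inE => /eqP x1 ->.
case: mu2 => _ _ <- _ _; rewrite mem_iota -x1; exact: col_lt.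
Qed.

(** The swap of a column is an odd element of the column stabiliser; reindexing the signed sum by it
    changes the sign. *)
Lemma antisym_to_sets ps : columns ps -> antisym ps (to_sets (polytabloid F t)).
Proof.
case=> _ psP p /psP[x [y [x0 y1 col_xy ->]]] A /=; set s0 := tperm (t x) (t y).
have s0_stab z : exists2 z', col_of z' = col_of z & s0 (t z) = t z'.
  rewrite /s0; case: tpermP => [/t_inj->|/t_inj->|_ _].
  - by exists y.
  - by exists x.
  - by exists z.
have stab s : s \in column_stab t -> (s * s0)%g \in column_stab t.
  rewrite !inE => /forallP s_stab; apply/forallP => z; apply/existsP.
  have /existsP[z' /andP[/eqP col_z /eqP sz]] := s_stab z.
  have [z'' col_z' s0z] := s0_stab z'; exists z''.
  by rewrite permM sz s0z col_z' col_z !eqxx.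
rewrite !to_sets_polytabloidE -sumrN (reindex_inj (mulIg s0)) /=.
apply: eq_big => [s|s _].
  apply/idP/idP => [/stab|]; last exact: stab.
  by rewrite -mulgA tperm2 mulg1.
rewrite odd_permM odd_tperm (_ : t x != t y); last first.
  by apply/eqP => /t_inj eq_xy; rewrite eq_xy y1 in x0.
rewrite addbT signrN mulNr; congr (- (_ * _%:R)).
have -> : (s * s0)%g @: second_row = s0 @: (s @: second_row).
  by rewrite -[RHS]imset_comp; apply: eq_imset => z; rewrite permM.
by rewrite (inj_eq (imset_inj perm_inj)).
Qed.

Lemma columns_exist : exists2 ps, columns ps & uniq (flat ps).
Proof.
have xy_ex (j : 'I_k) : exists xy : box mu * box mu,
    [/\ row_of xy.1 = 0%N, row_of xy.2 = 1%N, col_of xy.1 = j & col_of xy.2 = j].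
  case: mu2 => _ mu0 mu1 _ k2; have [|x x0 xj] := @box_at mu 0 j.
    by rewrite mu0; have := ltn_ord j; lia.
  by have [|y y1 yj] := @box_at mu 1 j; [rewrite mu1 | exists (x, y)].
have [xy xyP] := boolp.choice xy_ex.
exists [seq (t (xy j).1, t (xy j).2) | j <- enum 'I_k].
  split=> [|_ /mapP[j _ ->]]; first by rewrite size_map size_enum_ord.
  by exists (xy j).1, (xy j).2; case: (xyP j) => ? ? -> ->.
rewrite (perm_uniq (perm_flat _)) /unzip1 /unzip2 -!map_comp cat_uniq.
apply/and3P; split.
- rewrite map_inj_uniq -?enumT ?enum_uniq // => i j /= /t_inj eq_ij; apply: ord_inj.
  by have [_ _ <- _] := xyP i; have [_ _ <- _] := xyP j; rewrite eq_ij.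
- apply/hasPn => _ /mapP[j _ ->]; apply/negP => /mapP[i _ /= /t_inj eq_ij].
  by have [_ + _ _] := xyP j; have [+ _ _ _] := xyP i; rewrite eq_ij => ->.
- rewrite map_inj_uniq -?enumT ?enum_uniq // => i j /= /t_inj eq_ij; apply: ord_inj.
  by have [_ _ _ <-] := xyP i; have [_ _ _ <-] := xyP j; rewrite eq_ij.
Qed.

Lemma card_second_row : #|second_row| = k.
Proof.
have [ps ps_col ps_uniq] := columns_exist.
rewrite (columns_second_row ps_col ps_uniq) cardsE (card_uniqP (uniq_snd ps_uniq)).
by rewrite size_map; case: ps_col.
Qed.

Lemma to_sets_layer : to_sets (polytabloid F t) \in layer F _ k.+1.
Proof.
apply/layerP => A; rewrite eqSS to_sets_polytabloidE => Ak; apply: big1 => s _.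
case: (_ =P A) Ak => [<-|_ _]; last by rewrite mulr0.
by rewrite (card_imset _ perm_inj) card_second_row eqxx.
Qed.

(** Both sides are antisymmetric in the columns, live on k-subsets and take the value 1 at the
    second row. *)
Lemma polytabloid_pairprod ps : columns ps -> uniq (flat ps) ->
  to_sets (polytabloid F t) = pairprod F ps.
Proof.
move=> ps_col ps_uniq; have [size_ps _] := ps_col.
apply/eqP; rewrite -subr_eq0; apply/eqP; apply: (antisym_determined ps_uniq).
- move=> p p_ps A; have := antisym_to_sets ps_col p_ps A.
  have := antisym_pairprod F ps_uniq p_ps A; rewrite !ffunE => -> ->.
  by rewrite opprD.
- rewrite memvB ?pairprod_layer // size_ps; exact: to_sets_layer.
- rewrite -(columns_second_row ps_col ps_uniq) !ffunE.
  have := to_sets_polytabloid_second_row; rewrite ffunE => ->.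
  by rewrite (columns_second_row ps_col ps_uniq) pairprod1 // subrr.
Qed.

End Tableau.

Lemma columns_tableau ps : size ps = k -> uniq (flat ps) ->
  exists2 t : tableau m mu, injective t & columns t ps.
Proof.
case: mu2 => size_mu mu0 mu1 _ k2 size_ps ps_uniq.
pose s := enum [predC flat ps].
have flat_size : size (flat ps) = k.*2.
  by rewrite (perm_size (perm_flat ps)) size_cat !size_map addnn size_ps.
have all_uniq : uniq (unzip1 ps ++ unzip2 ps ++ s).
  rewrite catA cat_uniq -(perm_uniq (perm_flat ps)) ps_uniq enum_uniq andbT.
  apply/hasPn => i; rewrite mem_enum inE /= -(perm_mem (perm_flat ps)).
  exact.
have size_s : size s = (m - k.*2)%N.
  have := cardC (mem (flat ps)); rewrite (card_uniqP ps_uniq) card_ord flat_size.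
  by rewrite -cardE => eq_m; rewrite -[X in (X - _)%N]eq_m addKn.
pose pos (x : box mu) : nat :=
  if row_of x == 1%N then (k + col_of x)%N
  else if (col_of x < k)%N then col_of x else (k + col_of x)%N.
have pos_lt x : (pos x < m)%N.
  have := col_lt x; have := row_lt2 x; rewrite /pos.
  by case: (row_of x) => [|[|]] // _; rewrite ?mu0 ?mu1 /=; [case: ifP => ?|]; lia.
have pos_inj : injective pos.
  move=> x y; rewrite /pos; have := col_lt x; have := col_lt y.
  have := row_lt2 x; have := row_lt2 y.
  case ex: (row_of x) => [|[|]] //; case ey: (row_of y) => [|[|]] // _ _;
    rewrite ?mu0 ?mu1 /= => ? ?; do 2?[case: ifP => ?]; move=> ?;
    apply: box_inj; rewrite ?ex ?ey //; lia.
have size_all : size (unzip1 ps ++ unzip2 ps ++ s) == m.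
  by rewrite !size_cat !size_map size_ps size_s; apply/eqP; lia.
pose L := Tuple size_all.
pose t : tableau m mu := [ffun x => tnth L (Ordinal (pos_lt x))].
exists t; first by move=> x y; rewrite !ffunE => /(tuple_uniqP L all_uniq)[/pos_inj].
split=> // p p_ps; have j_lt : (index p ps < k)%N by rewrite -size_ps index_mem.
have [|x x0 xj] := @box_at mu 0 (index p ps); first by rewrite mu0; lia.
have [|y y1 yj] := @box_at mu 1 (index p ps); first by rewrite mu1.
exists x, y; split=> //; first by rewrite xj yj.
rewrite !ffunE !(tnth_nth p.1) /= /pos x0 y1 xj yj j_lt /= !nth_cat !size_map size_ps.
rewrite j_lt ltnNge leq_addr /= addKn j_lt.
by rewrite !(nth_map p) ?size_ps // nth_index //; case: (p).
Qed.

Lemma specht_mem (W : vectType F) (f : {linear Y -> W}) (U : {vspace W}) :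
  (forall t : tableau m mu, injective t -> f (polytabloid F t) \in U) ->
  forall v, v \in specht_space F m mu -> f v \in U.
Proof.
move=> fU v; have /subvP sub : (specht_space F m mu <= linfun f @^-1: U)%VS.
  apply/span_subvP => _ /mapP[t + ->]; rewrite mem_enum inE => /injectiveP t_inj.
  by rewrite -memv_preim lfunE; exact: fU.
by move/sub; rewrite -memv_preim lfunE.
Qed.

Lemma polytabloid_specht (t : tableau m mu) : injective t ->
  polytabloid F t \in specht_space F m mu.
Proof.
move=> t_inj; apply: memv_span; apply: map_f; rewrite mem_enum inE.
exact/injectiveP.
Qed.

Lemma specht_to_sets_layer v : v \in specht_space F m mu ->
  to_sets v \in layer F _ k.+1.
Proof. by apply: specht_mem => t; exact: to_sets_layer. Qed.

(** [lower] keeps the antisymmetry in k pairs, which forces zero on sets of fewer than k points; on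
    larger sets it reads the polytabloid at sets of more than k points, where it vanishes. *)
Lemma specht_lower v : v \in specht_space F m mu -> lower (to_sets v) = 0.
Proof.
move=> v_specht; apply/eqP; rewrite -memv0 -[lower _]/((@lower F _ \o to_sets) v).
apply: specht_mem v_specht => t t_inj; rewrite memv0; apply/eqP/ffunP => A /=.
have [ps ps_col ps_uniq] := columns_exist t_inj; have [size_ps _] := ps_col.
have anti := antisym_lower (antisym_to_sets t_inj ps_col).
have [A_lt|A_ge] := ltnP #|A| k.
  by rewrite (antisym_small ps_uniq anti) ?size_ps ?ffunE.
rewrite !ffunE; apply: big1 => i iA; apply: (layerP _ _ (to_sets_layer t_inj)).
by rewrite cardsU1 iA; lia.
Qed.

(** Its vanishing says that v is supported on the image of [rows_of]; in this linear form the
    property passes from polytabloids to their span. *)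
Definition off_rows (v : Y) : Y := [ffun r => if r \in codom rows_of then 0 else v r].

Fact off_rows_linear : linear off_rows.
Proof.
move=> c u v; apply/ffunP => r; rewrite !ffunE.
by case: ifP => _; rewrite ?ffunE // scaler0 addr0.
Qed.
HB.instance Definition _ := GRing.isLinear.Build F Y Y *:%R off_rows off_rows_linear.

Lemma specht_to_sets_inj v : v \in specht_space F m mu -> to_sets v = 0 -> v = 0.
Proof.
move=> v_specht /ffunP v0; have /ffunP off0 : off_rows v = 0.
  apply/eqP; rewrite -memv0; apply: specht_mem v_specht => t t_inj.
  rewrite memv0; apply/eqP/ffunP => r; rewrite !ffunE; case: ifP => // r_codom.
  rewrite sum_ffunE big1 // => s _; rewrite !ffunE tabloid_second_row //.
  by case: eqP r_codom => [->|_ _]; rewrite ?codom_f // [LHS]mulr0.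
apply/ffunP => r; have := off0 r; rewrite !ffunE; case: ifP => // /codomP[B ->] _.
by have := v0 B; rewrite !ffunE.
Qed.

Definition glue (x : rep_dsum (specht F m mu) (layer_rep m F k)) : X :=
  to_sets (vsval x.1) + raise (vsval x.2 : {ffun {set 'I_m} -> F^o}).

Fact glue_linear : linear glue.
Proof.
by move=> c u v; rewrite /glue /= !linearP /= scalerDr addrACA.
Qed.
HB.instance Definition _ := GRing.isLinear.Build F
  (rep_dsum (specht F m mu) (layer_rep m F k)) X *:%R glue glue_linear.

Lemma glue_act (s : 'S_m) x : glue (rep_act s x) = rep_act s (glue x).
Proof.
case: x => u v; rewrite /glue [RHS]linearD /= !vsprojK.
- by rewrite to_sets_act raise_act.
- exact/layer_stable/subvsP.
- exact/specht_stable/subvsP.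
Qed.

(** Applying [lower] to a relation u + U v = 0 leaves D U v = 0, so v = 0 by positivity and then u =
    0. *)
Lemma glue_inj : injective glue.
Proof.
apply: raddf_inj => -[u v]; rewrite /glue /= => uv0.
have eq_v : raise (vsval v : {ffun {set 'I_m} -> F^o}) = - to_sets (vsval u).
  by apply/eqP; rewrite -addr_eq0 addrC; apply/eqP.
have v0 : vsval v = 0.
  apply: (lower_raise_inj (subvsP v)).
    by rewrite card_ord; case: mu2 => _ _ _ _; lia.
  by rewrite eq_v linearN /= specht_lower ?oppr0 // subvsP.
have u0 : vsval u = 0.
  apply: (specht_to_sets_inj (subvsP u)); apply: oppr_inj; rewrite oppr0 -eq_v.
  exact: etrans (congr1 (@raise F _) v0) (linear0 _).
by congr (_, _); apply: val_inj.
Qed.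

(** The image contains every [raise u], and every [pairprod] because any k disjoint pairs are the
    columns of a tableau; [layer_span] concludes. *)
Lemma glue_surj v : v \in layer F _ k.+1 -> exists x, glue x = v.
Proof.
pose U := (limg (linfun (glue : rep_dsum _ _ -> X))).
suff vU : v \in layer F _ k.+1 -> v \in U.
  by move=> /vU/memv_imgP[x _ ->]; exists x; rewrite lfunE.
apply: layer_span => [ps size_ps ps_uniq|u u_layer].
  have [t t_inj t_col] := columns_tableau size_ps ps_uniq.
  rewrite -(polytabloid_pairprod t_inj t_col ps_uniq).
  apply/memv_imgP; exists (vsproj _ (polytabloid F t), 0); first exact: memvf.
  rewrite lfunE; transitivity (to_sets (polytabloid F t) + @raise F _ 0).
    by rewrite linear0 addr0.
  by congr (to_sets _ + raise _); apply/esym/vsprojK/polytabloid_specht.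
apply/memv_imgP; exists (0, vsproj _ u); first exact: memvf.
rewrite lfunE; transitivity (to_sets 0 + raise u); first by rewrite linear0 add0r.
by congr (to_sets _ + raise _); exact/esym/vsprojK.
Qed.

Lemma two_row_iso :
  rep_iso (rep_dsum (specht F m mu) (layer_rep m F k)) (layer_rep m F k.+1).
Proof.
apply: (@rep_iso_subrep _ _ _ _ _ _ glue).
- exact: glue_act.
- exact: glue_inj.
- case=> u v; apply: memvD; first exact/specht_to_sets_layer/subvsP.
  by apply/raise_layer; exact: subvsP.
- exact: glue_surj.
Qed.
End TwoRowSpecht.

(** * Kostka numbers with a two-part content and Young's rule *)

Section Kostka.
Variables (mu : seq nat) (p q : nat).
Hypotheses (mu_sorted : sorted geq mu) (mu_sum : sumn mu = (p + q)%N).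

Lemma nth_sorted i j : (i <= j)%N -> (nth 0%N mu j <= nth 0%N mu i)%N.
Proof.
move=> ij; have [j_lt|j_ge] := ltnP j (size mu); last by rewrite nth_default.
have := sorted_leq_nth (rev_trans leq_trans) leqnn 0%N mu_sorted.
by apply; rewrite ?inE // (leq_ltn_trans ij).
Qed.

Lemma box_above (x : box mu) i : (i <= row_of x)%N ->
  exists2 y : box mu, row_of y = i & col_of y = col_of x.
Proof. by move=> ix; apply: box_at; apply: leq_trans (col_lt x) (nth_sorted ix). Qed.

Lemma card_cols_le (A : {set box mu}) c :
  (forall x, x \in A -> row_of x = 0%N /\ (col_of x < c)%N) -> (#|A| <= c)%N.
Proof.
move=> Ac; rewrite cardE -(size_map (@col_of mu)) -[leqRHS](size_iota 0).
apply: uniq_leq_size => [|j /mapP[x]].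
  rewrite map_inj_in_uniq ?enum_uniq // => x y; rewrite !mem_enum.
  by move=> /Ac[x0 _] /Ac[y0 _]; apply: box_inj; rewrite x0 y0.
by rewrite mem_enum => /Ac[_ ?] ->; rewrite mem_iota.
Qed.

Lemma card_cols_ge (A : {set box mu}) c : (c <= nth 0%N mu 0)%N ->
  (forall x, row_of x = 0%N -> (col_of x < c)%N -> x \in A) -> (c <= #|A|)%N.
Proof.
move=> c_le Ac; rewrite cardE -(size_map (@col_of mu)) -[leqLHS](size_iota 0).
apply: uniq_leq_size => [|j]; first exact: iota_uniq.
rewrite mem_iota add0n /= => j_lt.
have [|x x0 xj] := @box_at mu 0 j; first exact: leq_trans c_le.
by rewrite -xj map_f // mem_enum Ac // xj.
Qed.

(** The condition in [kostka], kept convertible to it. *)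
Definition ssyt (T : {ffun box mu -> 'I_2}) : bool :=
  [&& [forall x, forall y, (row_of x == row_of y) &&
         (col_of x < col_of y)%N ==> (T x <= T y)%N],
      [forall x, forall y, (col_of x == col_of y) &&
         (row_of x < row_of y)%N ==> (T x < T y)%N]
    & [forall k, #|[set x | T x == k]| == nth 0%N [:: p; q] k]].

Lemma ssytP (T : {ffun box mu -> 'I_2}) : reflect
  [/\ forall x y, row_of x = row_of y -> (col_of x < col_of y)%N -> (T x <= T y)%N,
      forall x y, col_of x = col_of y -> (row_of x < row_of y)%N -> (T x < T y)%N
    & #|[set x | T x == 0]| = p]
  (ssyt T).
Proof.
apply: (iffP and3P) => [[/forallP rows /forallP cols /forallP cnt]|[rows cols cnt]].
  split=> [x y xy lt_xy|x y xy lt_xy|]; last exact/eqP/(cnt 0).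
    by have /forallP/(_ y)/implyP := rows x; apply; rewrite xy eqxx.
  by have /forallP/(_ y)/implyP := cols x; apply; rewrite xy eqxx.
split.
- by apply/forallP => x; apply/forallP => y; apply/implyP => /andP[/eqP xy];
    exact: rows.
- by apply/forallP => x; apply/forallP => y; apply/implyP => /andP[/eqP xy];
    exact: cols.
apply/forallP => k; apply/eqP.
have [->|k1] := eqVneq k 0; first by rewrite /= -cnt.
have := cardC [set x | T x == 0]; rewrite cnt card_box mu_sum => /addnI.
have -> : nth 0%N [:: p; q] k = q by case: k k1 => [[|[]]].
move=> <-; apply: eq_card => x; rewrite !inE.
by case: (T x) k k1 => [[|[|//]] ?] [[|[|//]] ?] /=.
Qed.

Section Valid.
Variable T : {ffun box mu -> 'I_2}.
Hypothesis T_ssyt : ssyt T.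

Lemma ssyt_below (x : box mu) : (0 < row_of x)%N -> T x = 1.
Proof.
have [_ cols _] := ssytP _ T_ssyt => x_gt0; have [y y0 yx] := box_above (leq0n (row_of x)).
have := cols y x yx; rewrite y0 => /(_ x_gt0).
by case: (T x) => [[|[|//]] ?] // _; apply: val_inj.
Qed.

Lemma ssyt_row (x : box mu) : (row_of x < 2)%N.
Proof.
rewrite ltnNge; apply/negP => x_ge2; have [_ cols _] := ssytP _ T_ssyt.
have [|y y1 yx] := @box_above x 1; first exact: ltnW.
have := cols y x yx; rewrite y1 => /(_ x_ge2).
by rewrite ssyt_below ?y1 // ssyt_below // (ltn_trans _ x_ge2).
Qed.

(** Strict columns confine the smaller letter to the first row, where weak rows make it an initial
    segment, of length p by the content. The tableau is therefore unique. *)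
Lemma ssyt_zero (x : box mu) : (T x == 0) = (row_of x == 0%N) && (col_of x < p)%N.
Proof.
have [rows cols cnt] := ssytP _ T_ssyt.
have [x0|x_neq0] /= := eqVneq (row_of x) 0%N; last by rewrite ssyt_below ?lt0n.
have zero_row y : T y == 0 -> row_of y = 0%N.
  by move=> Ty; apply/eqP; rewrite -leqn0 leqNgt; apply: contraTN Ty => /ssyt_below->.
(* If x holds the smaller letter, so do all boxes to its left; otherwise all p boxes with that
   letter lie strictly to its left. *)
rewrite -cnt; apply/idP/idP => [Tx|].
  apply: card_cols_ge => [|y y0]; first by have := col_lt x; rewrite x0.
  rewrite ltnS leq_eqVlt inE => /predU1P[yx|yx].
    by rewrite (box_inj (etrans y0 (esym x0)) yx).
  have := rows y x (etrans y0 (esym x0)) yx; rewrite (eqP Tx) leqn0 => /eqP Ty.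
  exact/eqP/val_inj.
apply: contraTT => Tx; rewrite -leqNgt; apply: card_cols_le => y; rewrite inE => Ty.
have y0 := zero_row y Ty; split=> //; rewrite ltnNge leq_eqVlt.
apply: contra Tx => /predU1P[xy|xy].
  by rewrite (box_inj (etrans x0 (esym y0)) xy).
have := rows x y (etrans x0 (esym y0)) xy; rewrite (eqP Ty) leqn0 => /eqP Tx.
exact/eqP/val_inj.
Qed.

Lemma ssyt_two_row : (0 < size mu)%N ->
  exists2 k, (k <= minn p q)%N & two_row (p + q) k mu.
Proof.
move=> size_mu; have [rows cols cnt] := ssytP _ T_ssyt.
pose k := nth 0%N mu 1; have k_le : (k <= nth 0%N mu 0)%N by apply: nth_sorted.
have muS i : nth 0%N mu i.+2 = 0%N.
  by case: (posnP (nth 0%N mu i.+2)) => // /box_at[x xi _]; have := ssyt_row x; rewrite xi.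
have sum2 : sumn mu = (nth 0%N mu 0 + k)%N.
  rewrite /k; case: mu muS => [|x [|y s]] //= s0; by rewrite sumn_nth0 ?addn0.
have k_p : (k <= p)%N.
  case: (posnP k) => [->//|k_gt0]; have [|y y1 yk] := @box_at mu 1 k.-1.
    by rewrite -/k prednK.
  have [x x0 xy] := box_above (leq0n (row_of y)).
  suff : T x == 0 by rewrite ssyt_zero xy yk prednK // => /andP[].
  have := cols x y xy; rewrite x0 y1 => /(_ isT).
  by rewrite (ssyt_below (x := y)) ?y1 // ltnS leqn0 => /eqP Tx; exact/eqP/val_inj.
(* As the two rows have p + q boxes in all, this amounts to k <= q. *)
have p_le : (p <= nth 0%N mu 0)%N.
  rewrite -cnt; apply: card_cols_le => x; rewrite inE ssyt_zero => /andP[/eqP x0 _].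
  by have := col_lt x; rewrite x0.
by exists k; [lia | split=> //; lia].
Qed.

End Valid.

Lemma kostka_le1 : (kostka mu [:: p; q] <= 1)%N.
Proof.
apply/card_le1_eqP => T U; rewrite !inE => T_ssyt U_ssyt.
apply/ffunP => x; have := ssyt_zero T_ssyt x; rewrite -(ssyt_zero U_ssyt x).
by case: (T x) (U x) => [[|[|//]] ?] [[|[|//]] ?] /= // _; apply: val_inj.
Qed.

Lemma two_row_ssyt k : (k <= minn p q)%N -> two_row (p + q) k mu ->
  exists T : {ffun box mu -> 'I_2}, ssyt T.
Proof.
move=> k_le mu2; have [_ mu0 mu1 muS _] := mu2.
(* Here k <= p makes the columns strict, and k <= q ensures that the first row has room for p
   boxes. *)
exists [ffun x => if (row_of x == 0%N) && (col_of x < p)%N then 0 else 1].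
apply/ssytP; split=> [x y xy lt_xy|x y xy lt_xy|].
- rewrite !ffunE xy; case: (row_of y == 0%N) => //=.
  by case: ifP => // x_p; case: ifP => // y_p; move: x_p y_p lt_xy; lia.
- have y1 : row_of y = 1%N by have := row_lt2 mu2 y; lia.
  have x0 : row_of x = 0%N by lia.
  have := col_lt y; rewrite !ffunE x0 y1 mu1 xy /= => y_k.
  by rewrite (leq_trans y_k) //; lia.
apply/eqP; rewrite eqn_leq; apply/andP; split.
  apply: card_cols_le => x; rewrite inE ffunE; case: ifP => // /andP[/eqP-> ->] //.
apply: card_cols_ge => [|x x0 xp]; first by rewrite mu0; lia.
by rewrite inE ffunE x0 xp.
Qed.

Lemma kostka_eq1 : (0 < size mu)%N ->
  (kostka mu [:: p; q] == 1%N) <-> exists2 k, (k <= minn p q)%N & two_row (p + q) k mu.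
Proof.
move=> size_mu; split=> [/cards1P[T eq_T]|[k k_le /(two_row_ssyt k_le)[T T_ssyt]]].
  have /setP/(_ T) := eq_T; rewrite !inE eqxx => T_ssyt.
  exact: (ssyt_two_row (T_ssyt : ssyt T)).
rewrite eqn_leq kostka_le1 /=; apply/card_gt0P; exists T; rewrite inE; exact: T_ssyt.
Qed.

End Kostka.

Lemma intpart_sorted m (mu : intpart m) : sorted geq mu.
Proof. by case/andP: (valP mu). Qed.

Lemma intpart_sum m (mu : intpart m) : sumn mu = m.
Proof. by case/andP: (valP mu) => _ /eqP. Qed.

Lemma intpart_size m (mu : intpart m) : size mu = m.
Proof. by rewrite size_map size_tuple. Qed.

Lemma parts_inj m : injective (@parts m).
Proof. by move=> mu nu /(inj_map (@ord_inj _))/val_inj/val_inj. Qed.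

Lemma two_row_inj m k (mu nu : intpart m) :
  two_row m k mu -> two_row m k nu -> mu = nu.
Proof.
move=> [_ mu0 mu1 muS _] [_ nu0 nu1 nuS _]; apply: parts_inj.
apply: (@eq_from_nth _ 0%N) => [|i _]; first by rewrite !intpart_size.
by case: i => [|[|i]]; rewrite ?mu0 ?mu1 ?muS ?nu0 ?nu1 ?nuS.
Qed.

Lemma two_row_exists m k : (0 < m)%N -> (k.*2 <= m)%N ->
  exists mu : intpart m, two_row m k mu.
Proof.
move=> m_gt0 k2; pose t : m.-tuple 'I_m.+1 :=
  [tuple inord (nth 0%N [:: m - k; k] i)%N | i < m].
have size_t : size [seq nat_of_ord j | j <- t] = m by rewrite size_map size_tuple.
have t_nth i : nth 0%N [seq nat_of_ord j | j <- t] i = nth 0%N [:: m - k; k]%N i.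
  have [i_lt|i_ge] := ltnP i m.
    rewrite (nth_map ord0) ?size_tuple // -(tnth_nth _ _ (Ordinal i_lt)).
    by rewrite tnth_mktuple inordK //; case: i i_lt => [|[|i]] /=; rewrite ?nth_nil; lia.
  (* A second part beyond the tuple can only occur for m = 1, where k = 0 agrees with the default
     value. *)
  rewrite nth_default; last by rewrite size_t.
  by case: i i_ge => [|[|i]] /=; rewrite ?nth_nil; lia.
have t2 : two_row m k [seq nat_of_ord j | j <- t].
  by split; rewrite ?t_nth ?size_t // => i; rewrite t_nth /= nth_nil.
have t_part : sorted geq [seq nat_of_ord j | j <- t] &&
    (sumn [seq nat_of_ord j | j <- t] == m).
  rewrite (sumn_two_row t2) eqxx andbT; apply/(sortedP 0%N) => i _; rewrite !t_nth.
  by case: i => [|[|i]] /=; rewrite ?nth_nil //; lia.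
by exists (Sub t t_part).
Qed.

Section YoungRule.
Variables (F : numClosedFieldType) (m : nat) (H : groupType).
Variable f : UMagmaMorphism.type H 'S_m.
Hypothesis m_gt0 : (0 < m)%N.

Lemma layer_rep0 : rep_iso (rep_pull f (layer_rep m F 0)) (rep_zero F H).
Proof.
have u0 (u : rep_pull f (layer_rep m F 0)) : u = 0.
  by apply: val_inj; exact: layer0 (subvsP u).
exists (\0 : {linear _ -> _}); first by exists (fun _ => 0) => [u|v]; [exact/esym/u0 | rewrite [v]thinmx0].
by move=> g v; rewrite [LHS]thinmx0 [RHS]thinmx0.
Qed.

(** Iterates [two_row_iso] down to the zero module [layer 0]. The list of shapes is characterised so
    that it can be matched with the support of the Kostka numbers. *)
Lemma layer_decomposition k : (k.*2 <= m)%N -> exists s : seq (intpart m),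
  [/\ uniq s, forall mu : intpart m, mu \in s <-> exists2 i, (i <= k)%N & two_row m i mu
    & rep_iso (rep_pull f (layer_rep m F k.+1))
        (\big[@rep_dsum _ _/@rep_zero _ _]_(mu <- s) rep_pull f (specht F m mu))].
Proof.
have step i (mu : intpart m) : two_row m i mu -> rep_iso
    (rep_dsum (rep_pull f (specht F m mu)) (rep_pull f (layer_rep m F i)))
    (rep_pull f (layer_rep m F i.+1)).
  move=> mu2; apply: rep_iso_trans (rep_iso_pull f (two_row_iso F mu2)).
  exact: rep_iso_sym (rep_iso_pull_dsum _ _ _).
elim: k => [_|k IHk k2].
  have [mu mu2] := two_row_exists m_gt0 (isT : 0.*2 <= m)%N.
  exists [:: mu]; split=> // [nu|].
    rewrite inE; split=> [/eqP->|]; first by exists 0%N.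
    by case=> i; rewrite leqn0 => /eqP-> /(two_row_inj mu2)->.
  rewrite big_cons big_nil; apply: rep_iso_trans (rep_iso_sym (step _ _ mu2)) _.
  exact: rep_iso_dsum (rep_iso_refl _) layer_rep0.
have [|s [s_uniq sP s_iso]] := IHk; first by lia.
have [mu mu2] := two_row_exists m_gt0 k2.
exists (mu :: s); split.
- rewrite /= s_uniq andbT; apply/negP => /sP[i i_le [_ _ mu1 _ _]].
  by case: mu2 => _ _ + _ _; rewrite mu1; lia.
- move=> nu; rewrite inE; split=> [/predU1P[->|/sP[i i_le nu2]]|].
  + by exists k.+1.
  + by exists i => //; lia.
  case=> i; rewrite leq_eqVlt => /predU1P[->|i_le nu2].
    by move/(two_row_inj mu2)->; rewrite eqxx.
  by apply/orP; right; apply/sP; exists i.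
rewrite big_cons; apply: rep_iso_trans (rep_iso_sym (step _ _ mu2)) _.
exact: rep_iso_dsum (rep_iso_refl _) s_iso.
Qed.

Lemma young_rule p q : (p + q)%N = m ->
  rep_iso (rep_pull f (layer_rep m F (minn p q).+1))
    (\big[@rep_dsum _ _/@rep_zero _ _]_(mu : intpart m)
       rep_copies (kostka mu [:: p; q]) (rep_pull f (specht F m mu))).
Proof.
move=> pq; have [|s [s_uniq sP s_iso]] := @layer_decomposition (minn p q).
  by lia.
apply: rep_iso_trans s_iso (rep_iso_sym _).
apply: rep_iso_trans (big_copies _ _ _) _ => [mu|].
  by rewrite kostka_le1 ?intpart_sorted // intpart_sum pq.
apply: perm_big_dsum; apply: uniq_perm => // [|mu].
  by rewrite filter_uniq // index_enum_uniq.
rewrite mem_filter mem_index_enum andbT.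
have := kostka_eq1 (intpart_sorted mu) (etrans (intpart_sum mu) (esym pq)).
rewrite intpart_size pq => /(_ m_gt0) kP.
by apply/idP/idP => [/kP/sP|/sP/kP].
Qed.

End YoungRule.

(** * Promotion of standard tableaux of hook shape *)

Section Hook.
Local Open Scope nat_scope.
Variables a b : nat.
Local Notation lam := (hook a.+1 b).
Local Notation n := (a + b).+1.
Implicit Types (d : bool) (i j k v : nat) (f g : box lam -> nat) (x y : box lam).

(* The direction d is true for the leg (the first column) and false for the arm
   (the first row). *)
Definition arm_size d : nat := if d then b.+1 else a.+1.

Lemma nth_hook i : nth 0 lam i = if i == 0 then a.+1 else (i <= b : nat).
Proof. by case: i => // i; rewrite /= nth_nseq; case: ltnP. Qed.

Fact corner_subproof : (0, 0) \in diagram lam.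
Proof. by rewrite mem_diagram nth_hook. Qed.

Definition corner : box lam := SeqSub corner_subproof.

(* The box at distance j from the corner, or the corner if there is none. *)
Definition box_on d j : box lam := insubd corner (if d then (j, 0) else (0, j)).

Lemma mem_on d j : ((if d then (j, 0) else (0, j)) \in diagram lam) = (j < arm_size d).
Proof.
case: d; rewrite mem_diagram nth_hook //.
by case: eqP => [->//|_]; rewrite /arm_size ltnS; case: (j <= b).
Qed.

Lemma box_onE d j : j < arm_size d ->
  row_of (box_on d j) = (if d then j else 0) /\ col_of (box_on d j) = (if d then 0 else j).
Proof.
by move=> j_lt; rewrite /row_of /col_of -!/(val _) val_insubd mem_on j_lt; case: (d).
Qed.

Lemma box_on0 d : box_on d 0 = corner.
Proof.
have [|r c] := @box_onE d 0; first by case: d.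
by apply: box_inj; rewrite ?r ?c; case: d {r c}.
Qed.

Lemma box_onP x : exists d j, j < arm_size d /\ x = box_on d j.
Proof.
have := col_lt x; rewrite nth_hook; case: eqP => [x0 x_lt|/eqP x_neq0].
  exists false, (col_of x); split=> //.
  by have [r c] := box_onE (x_lt : col_of x < arm_size false); apply: box_inj; rewrite ?r ?c.
case: (leqP (row_of x) b) => // x_b x_lt; exists true, (row_of x); split=> //.
have x0 : col_of x = 0 by case: (col_of x) x_lt.
by have [r c] := box_onE (x_b : row_of x < arm_size true); apply: box_inj; rewrite ?r ?c ?x0.
Qed.

Lemma box_on_inj d e i j : i < arm_size d -> j < arm_size e ->
  box_on d i = box_on e j -> i = j /\ (i = 0 \/ d = e).
Proof.
move=> /box_onE[ri ci] /box_onE[rj cj] eq_ij; move: ri ci rj cj; rewrite eq_ij {eq_ij}.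
by move=> -> ->; case: d; case: e => /= ? ?; split; by [lia | left; lia | right].
Qed.

Definition step d x : option (box lam) := if d then south x else east x.

Lemma step_on d j : j < arm_size d ->
  step d (box_on d j) = if j.+1 < arm_size d then Some (box_on d j.+1) else None.
Proof.
move=> j_lt; have [rj cj] := box_onE j_lt.
have -> : step d (box_on d j) = insub (if d then (j.+1, 0) else (0, j.+1)).
  by rewrite /step /south /east rj cj; case: (d).
by rewrite -mem_on /box_on /insubd; case: insubP => [u -> //|/negbTE->].
Qed.

Lemma step_off d j : 0 < j < arm_size d -> step (~~ d) (box_on d j) = None.
Proof.
case/andP=> j_gt0 j_lt; have [rj cj] := box_onE j_lt; rewrite /step /south /east rj cj.
case: d {rj cj} j_lt => j_lt /=; apply: insubN; rewrite mem_diagram nth_hook /=.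
  by rewrite gtn_eqF //; case: (j <= b).
by case: (0 < b); lia.
Qed.

(** Stated relative to a direction, so that one argument serves both arms. A tie goes south, whence
    the two comparisons. *)
Lemma slide_targetE k f d x : slide_target k f x =
  match within k f (step d x), within k f (step (~~ d) x) with
  | Some y, Some z => Some (if (if d then f y <= f z else f y < f z) then y else z)
  | Some y, None => Some y
  | None, o => o
  end.
Proof.
case: d; rewrite /slide_target /step //=.
case: (within k f (east x)) => [y|]; case: (within k f (south x)) => [z|] //.
by rewrite (leqNgt (f z)); case: (f y < f z).
Qed.

(** Off the corner the dummy box can only continue along its arm; it stops at p, just before the
    first entry above k or at the end. *)
Lemma slide_on k d fuel f j : 0 < j < arm_size d -> arm_size d <= j + fuel ->
  exists p, [/\ j <= p < arm_size d,
    forall i, j < i <= p -> f (box_on d i) <= k,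
    p.+1 < arm_size d -> k < f (box_on d p.+1),
    (slide fuel k f (box_on d j)).2 = box_on d p &
    [/\ forall i, j <= i < p -> (slide fuel k f (box_on d j)).1 (box_on d i) = f (box_on d i.+1)
      & forall x, (forall i, j <= i <= p -> x <> box_on d i) ->
          (slide fuel k f (box_on d j)).1 x = f x]].
Proof.
elim: fuel f j => [|fuel IHfuel] f j j_lt fuel_ge; first by lia.
rewrite /= (slide_targetE k f d) step_off // step_on; last by lia.
have stop : (j.+1 < arm_size d -> k < f (box_on d j.+1)) ->
    exists p, [/\ j <= p < arm_size d,
    forall i, j < i <= p -> f (box_on d i) <= k,
    p.+1 < arm_size d -> k < f (box_on d p.+1),
    box_on d j = box_on d p & [/\ forall i, j <= i < p -> f (box_on d i) = f (box_on d i.+1)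
      & forall x, (forall i, j <= i <= p -> x <> box_on d i) -> f x = f x]].
  by move=> k_lt; exists j; split=> //; [lia | by move=> i; lia | by split=> // i; lia].
case: ifP => [j1_lt|j1_ge] /=; last by apply: stop; rewrite j1_ge.
case: leqP => [f_le|f_gt]; last exact: stop.
have [||p [p_lt fk kf out2 [out1 out]]] :=
    IHfuel (fun z => if z == box_on d j then f (box_on d j.+1) else f z) j.+1; [lia | lia |].
have neq_j i : j < i < arm_size d -> (box_on d i == box_on d j) = false.
  by move=> i_lt; apply/eqP => /box_on_inj[]; lia.
exists p; split=> //; first by lia.
- move=> i i_lt; have [->|neq_i] := eqVneq i j.+1; first by [].
  have := fk i; rewrite neq_j; last by lia.
  by apply; lia.
- by move=> p1_lt; have := kf p1_lt; rewrite neq_j //; lia.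
split=> [i i_lt|x x_off].
  have [->|neq_i] := eqVneq i j.
    rewrite out ?eqxx // => l l_lt /esym/eqP; rewrite neq_j //; lia.
  rewrite out1; last by lia.
  by rewrite neq_j //; lia.
rewrite out => [|i i_lt]; last by apply: x_off; lia.
by case: eqP => // /x_off; case; lia.
Qed.

Definition on_arm d f v : Prop := exists2 i, 0 < i < arm_size d & f (box_on d i) = v.

(** Standardness for the [nat]-valued fillings on which [promotion] operates, phrased arm by arm;
    that all of 1, ..., n occur follows by counting in [hook_standard_perm]. *)
Definition hook_standard f : Prop :=
  [/\ f corner = 1,
      forall d v, on_arm d f v -> 2 <= v <= n,
      forall d i j, 0 < i < j -> j < arm_size d -> f (box_on d i) < f (box_on d j)
    & forall v, on_arm false f v -> on_arm true f v -> False].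

Section Standard.
Variable f : box lam -> nat.
Hypothesis f_std : hook_standard f.

Lemma hook_standard_gt1 d i : 0 < i < arm_size d -> 1 < f (box_on d i).
Proof.
case: f_std => _ f_range _ _ i_lt.
by have [|] := andP (f_range d (f (box_on d i)) _); [exists i|].
Qed.

Lemma hook_standard_inj : injective f.
Proof.
have [f1 f_range f_mono f_disj] := f_std.
move=> x y; have [d [i [i_lt ->]]] := box_onP x; have [e [j [j_lt ->]]] := box_onP y.
have [->|i_gt0] := posnP i; have [->|j_gt0] := posnP j; rewrite ?box_on0 ?f1 //.
- by move=> eq_f; have := @hook_standard_gt1 e j; rewrite -eq_f j_gt0 j_lt => /(_ isT).
- by move=> eq_f; have := @hook_standard_gt1 d i; rewrite eq_f i_gt0 i_lt => /(_ isT).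
have [eq_de|neq_de] := eqVneq d e; last first.
  move=> eq_f; exfalso; apply: (f_disj (f (box_on d i)));
    case: d e neq_de i_lt j_lt eq_f => [] [] // _ i_lt j_lt eq_f;
    by [exists i; rewrite ?i_gt0 | exists j; rewrite ?j_gt0 ?eq_f].
rewrite -eq_de in j_lt *; case: (ltngtP i j) => [ij|ji|->] // eq_f.
  by have := f_mono d i j; rewrite eq_f ltnn i_gt0 ij => /(_ isT j_lt).
by have := f_mono d j i; rewrite eq_f ltnn j_gt0 ji => /(_ isT i_lt).
Qed.

Lemma sumn_hook : sumn lam = n.
Proof. by rewrite /= sumn_nseq mul1n addSn. Qed.

Lemma hook_standard_perm : perm_eq [seq f x | x : box lam] (iota 1 n).
Proof.
have [f1 f_range _ _] := f_std.
have uniq_f : uniq [seq f x | x : box lam].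
  by rewrite map_inj_uniq ?enum_uniq //; exact: hook_standard_inj.
apply: uniq_perm => //; first exact: iota_uniq.
apply: (uniq_min_size uniq_f _ _).2 => [_ /mapP[x _ ->]|].
  rewrite mem_iota; have [d [j [j_lt ->]]] := box_onP x.
  have [->|j_gt0] := posnP j; first by rewrite box_on0 f1.
  by have := f_range d (f (box_on d j)); rewrite add1n ltnS => /(_ _)/andP[|/ltnW-> //]; exists j; rewrite ?j_gt0.
by rewrite size_iota size_image card_box sumn_hook.
Qed.

Lemma on_arm_surj v : 2 <= v <= n -> exists d, on_arm d f v.
Proof.
move=> v_n; have : v \in [seq f x | x : box lam].
  by rewrite (perm_mem hook_standard_perm) mem_iota; lia.
case/mapP=> x _; have [d [j [j_lt ->]]] := box_onP x; have [->|j_gt0] := posnP j.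
  by rewrite box_on0; case: f_std => -> _ _ _ v1; lia.
by exists d, j; rewrite ?j_gt0.
Qed.

Lemma on_arm_compl v : on_arm false f v <-> 2 <= v <= n /\ ~ on_arm true f v.
Proof.
have [_ f_range _ f_disj] := f_std; split=> [f_v|[/on_arm_surj[[]]//]].
by split; [exact: f_range f_v | move/(f_disj _ f_v)].
Qed.

End Standard.

Definition rot_entry k v : nat := if v <= k then if v == 2 then k else v.-1 else v.

Lemma promotionE k f : hook_standard f -> let s := slide #|{: box lam}| k f corner in
  promotion k f =
  fun z => if z == s.2 then k else if s.1 z <= k then (s.1 z).-1 else s.1 z.
Proof.
move=> f_std; have [f1 _ _ _] := f_std; rewrite /promotion.
case: pickP => [x /eqP fx|/(_ corner)]; last by rewrite f1.
have -> : x = corner by apply: (hook_standard_inj f_std); rewrite fx f1.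
by case: slide.
Qed.

Lemma promotion1 f : hook_standard f -> promotion 1 f =1 f.
Proof.
move=> f_std; have [f1 f_range _ _] := f_std; rewrite promotionE // card_box sumn_hook.
have within1 d : within 1 f (step d corner) = None.
  rewrite -(box_on0 d) step_on; last by case: (d).
  case: ifP => //= lt1; have [|] := andP (f_range d (f (box_on d 1)) _); first by exists 1.
  by case: ltnP.
rewrite /= (slide_targetE 1 f true) !within1 => x /=.
case: eqP => [->|neq_x]; first by rewrite f1.
case: ifP => // fx_le; case: neq_x; apply: (hook_standard_inj f_std); rewrite f1.
have [d [j [j_lt eq_x]]] := box_onP x; have [j0|j_gt0] := posnP j.
  by rewrite eq_x j0 box_on0.
have [|] := andP (f_range d (f x) _); first by exists j; rewrite ?j_gt0 ?eq_x.
by rewrite ltnNge fx_le.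
Qed.

(** The arm d is the one that holds 2, necessarily next to the corner: the dummy box enters it and
    stops at the last entry at most k, while the other arm is merely relabelled. *)
Lemma promotion_path k f : hook_standard f -> 2 <= k <= n ->
  exists d p, [/\ 0 < p < arm_size d, f (box_on d 1) = 2,
    forall i, i < p -> promotion k f (box_on d i) = (f (box_on d i.+1)).-1 /\
                       f (box_on d i.+1) <= k,
    promotion k f (box_on d p) = k &
    [/\ forall i, p < i < arm_size d -> promotion k f (box_on d i) = f (box_on d i) /\
                       k < f (box_on d i) &
        forall i, 0 < i < arm_size (~~ d) ->
          promotion k f (box_on (~~ d) i) = rot_entry k (f (box_on (~~ d) i)) /\
          2 < f (box_on (~~ d) i)]].
Proof.
move=> f_std k_n; have [f1 f_range f_mono f_disj] := f_std.
have [|d [i /andP[i_gt0 i_lt] fi]] := @on_arm_surj f f_std 2; first by lia.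
have eq_i : i = 1.
  have [//|i_neq1] := eqVneq i 1; have lt2 : f (box_on d 1) < 2.
    by rewrite -fi; apply: f_mono => //; lia.
  have [|] := andP (f_range d (f (box_on d 1)) _); first by exists 1; lia.
  by lia.
rewrite {i}eq_i in i_gt0 i_lt fi.
have other i : 0 < i < arm_size (~~ d) -> 2 < f (box_on (~~ d) i).
  move=> i_lt'; have [|] := andP (f_range (~~ d) (f (box_on (~~ d) i)) _).
    by exists i.
  rewrite leq_eqVlt => /predU1P[eq2|//] _; exfalso.
  have d2 : on_arm d f 2 by exists 1.
  have nd2 : on_arm (~~ d) f 2 by exists i.
  by case: (d) d2 nd2 => /= d2 nd2; exact: (f_disj 2).
have target : slide_target k f corner = Some (box_on d 1).
  rewrite (slide_targetE k f d) -{1}(box_on0 d) -(box_on0 (~~ d)).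
  rewrite !step_on ?i_lt /= ?fi; [|by case: (~~ d)|by case: (d)].
  have -> : 2 <= k by lia.
  case: ifP => //= lt1; case: ifP => // _; have := other 1 lt1.
  by rewrite fi => gt2; rewrite gt2 (ltnW gt2) if_same.
(* The filling after the first slide, which leaves [a + b] of the n units of fuel. *)
pose g z := if z == corner then f (box_on d 1) else f z.
have [||p [p_lt fk kf out2 [out1 out]]] :=
    @slide_on k d (a + b) g 1; [lia | by case: (d); rewrite /arm_size; lia |].
have promE : promotion k f = fun z => if z == box_on d p then k else
    let v := (slide (a + b) k g (box_on d 1)).1 z in if v <= k then v.-1 else v.
  by rewrite promotionE // card_box sumn_hook /= target out2.
have neq_corner e i : 0 < i < arm_size e -> (box_on e i == corner) = false.
  by move=> i_lt'; apply/eqP; rewrite -(box_on0 e) => /box_on_inj[]; lia.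
have g_on e i : 0 < i < arm_size e -> g (box_on e i) = f (box_on e i).
  by move=> i_lt'; rewrite /g neq_corner.
have neq_on i j : i < arm_size d -> j < arm_size d -> i <> j ->
    (box_on d i == box_on d j) = false.
  by move=> i_lt' j_lt neq_ij; apply/eqP => /box_on_inj[].
exists d, p; split=> //; try lia.
- move=> i i_p; have fi_k : f (box_on d i.+1) <= k.
    case: i i_p => [|i] i_p; first by rewrite fi; lia.
    by have := fk i.+2; rewrite g_on; [apply; lia | lia].
  split=> //; rewrite promE neq_on; [|lia|lia|lia].
  have [i0|i_gt0'] := posnP i.
    rewrite i0 out /= => [|j j_lt /eqP]; last first.
      by rewrite eq_sym box_on0 neq_corner //; lia.
    by rewrite box_on0 /g eqxx fi; case: ifP => //; lia.
  by rewrite out1 /= ?g_on ?fi_k //; lia.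
- by rewrite promE eqxx.
split=> i i_lt'.
  have k_lt : k < f (box_on d i).
    have k_p : k < f (box_on d p.+1) by have := kf; rewrite g_on; [apply; lia | lia].
    have [->//|neq_i] := eqVneq i p.+1.
    by apply: ltn_trans k_p (f_mono _ _ _ _ _); lia.
  split=> //; rewrite promE neq_on; [|lia|lia|lia].
  rewrite out /= ?g_on; [|lia|]; first by rewrite leqNgt k_lt.
  by move=> j j_lt /eqP; rewrite neq_on //; lia.
have off j : j < arm_size d -> box_on (~~ d) i <> box_on d j.
  by move=> j_lt /box_on_inj[|//|? []]; [lia | lia | case: (d)].
split; last exact: other.
rewrite promE; case: eqP => [/off|_]; first by lia.
rewrite out /= ?g_on // /rot_entry => [|j j_lt]; last by apply: off; lia.
by have := other i i_lt'; case: eqP => // ->.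
Qed.

(** The entry 2 leaves its arm for the corner, and the new label k appears on that same arm; all
    other labels stay on their arm. *)
Lemma promotion_hook k f : hook_standard f -> 0 < k <= n ->
  hook_standard (promotion k f) /\
  forall d v, on_arm d (promotion k f) v <-> exists2 u, on_arm d f u & v = rot_entry k u.
Proof.
move=> f_std k_n; have [f1 f_range f_mono f_disj] := f_std.
have [k1|k_neq1] := eqVneq k 1.
  rewrite k1; have eq_f := promotion1 f_std.
  have arm_eq d v : on_arm d (promotion 1 f) v <-> on_arm d f v.
    by split=> -[i i_lt]; [rewrite eq_f | rewrite -eq_f]; exists i.
  split=> [|d v].
    split; rewrite ?eq_f //.
    - by move=> d v /arm_eq; exact: f_range.
    - by move=> d i j; rewrite !eq_f; exact: f_mono.
    - by move=> v /arm_eq ? /arm_eq; exact: f_disj.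
  rewrite arm_eq; split=> [f_v|[u f_u ->]].
    by exists v => //; have := f_range _ _ f_v; rewrite /rot_entry; case: ifP; lia.
  by have := f_range _ _ f_u; rewrite /rot_entry; case: ifP => //; lia.
have k_n2 : 2 <= k <= n by lia.
have [d [p [p_lt fd1 lo_p at_p [hi_p other]]]] := promotion_path f_std k_n2.
have arm e v : on_arm e (promotion k f) v <-> exists2 u, on_arm e f u & v = rot_entry k u.
  have [->|neq_e] := eqVneq e d; last first.
    have -> : e = ~~ d by case: e d {p_lt fd1 lo_p at_p hi_p other} neq_e => [] [].
    split=> [[i i_lt <-]|[u [i i_lt <-] ->]].
      by have [-> _] := other i i_lt; exists (f (box_on (~~ d) i)) => //; exists i.
    by have [<- _] := other i i_lt; exists i.
  split=> [[i i_lt <-]|[u [i i_lt <-] ->]].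
    case: (ltngtP i p) => [i_p|p_i|->].
    - have [-> le_k] := lo_p i i_p; exists (f (box_on d i.+1)); first by exists i.+1; lia.
      rewrite /rot_entry le_k; case: eqP => // eq2.
      by have := f_mono d 1 i.+1; lia.
    - have [|-> k_lt] := hi_p i; first by lia.
      by exists (f (box_on d i)); [exists i | rewrite /rot_entry leqNgt k_lt].
    - exists 2; first by exists 1; lia.
      by rewrite at_p /rot_entry eqxx; case: ifP; lia.
  have [->|i_neq1] := eqVneq i 1.
    by exists p; rewrite // at_p fd1 /rot_entry eqxx; case: ifP; lia.
  case: (leqP i p) => [i_p|p_i].
    have [|prom_i le_k] := lo_p i.-1; first by lia.
    have eq_i : i.-1.+1 = i by lia.
    rewrite eq_i in prom_i le_k; exists i.-1; first by lia.
    rewrite prom_i /rot_entry le_k; by case: eqP => // eq2; have := f_mono d 1 i; lia.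
  have [|prom_i k_lt] := hi_p i; first by lia.
  by exists i => //; rewrite prom_i /rot_entry leqNgt k_lt.
split=> //; split.
- by have [|] := lo_p 0; [lia | rewrite box_on0 fd1].
- move=> e v /arm[u /f_range u_n ->]; rewrite /rot_entry.
  by case: ifP => //; case: eqP; lia.
- move=> e i j i_j j_lt; have [eq_e|neq_e] := eqVneq e d; last first.
    have eq_e : e = ~~ d by case: e d neq_e {arm p_lt fd1 lo_p at_p hi_p other j_lt} => [] [].
    rewrite eq_e in j_lt *; have [|-> i2] := other i; first by lia.
    have [|-> j2] := other j; first by lia.
    have := f_mono (~~ d) i j i_j j_lt; rewrite /rot_entry.
    by do 2![case: ifP => ?; rewrite ?gtn_eqF //]; lia.
  rewrite {e}eq_e in j_lt *.
  case: (ltngtP i p) => i_p; case: (ltngtP j p) => j_p; try by lia.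
  + have [-> _] := lo_p i i_p; have [-> _] := lo_p j j_p.
    have := f_mono d i.+1 j.+1; have := @hook_standard_gt1 f f_std d i.+1; lia.
  + have [-> ?] := lo_p i i_p; have [|-> ?] := hi_p j; first by lia.
    lia.
  + rewrite j_p at_p; have [-> ?] := lo_p i i_p.
    by have := @hook_standard_gt1 f f_std d i.+1; lia.
  + have [|-> ?] := hi_p i; first by lia.
    have [|-> ?] := hi_p j; first by lia.
    exact: f_mono.
  + by rewrite i_p at_p; have [|-> ?] := hi_p j; lia.
- move=> v /arm[u1 u1_f v1] /arm[u2 u2_f v2].
  have eq_u : u1 = u2.
    have := f_range _ _ u1_f; have := f_range _ _ u2_f.
    have := etrans (esym v1) v2; rewrite /rot_entry.
    by repeat (case: ifP => ?); lia.
  by apply: (f_disj u1); rewrite // eq_u.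
Qed.

Local Ltac reverse_cases :=
  repeat match goal with |- context [reverse_in ?c ?d ?x] =>
    lazymatch x with context [reverse_in] => fail | _ =>
      case: (reverse_inP c d x) => [[? [? ->]]|[? ->]] end end.

(** Rotating [2, k + 1] and then reversing [2, k] reverses [2, k + 1]: 2 goes to k + 1 and stays
    there, any other v goes to v - 1 and then to k + 3 - v. *)
Lemma xi1_hook k f : hook_standard f -> k <= n ->
  hook_standard (xi1 k f) /\
  forall d v, on_arm d (xi1 k f) v <-> exists2 u, on_arm d f u & v = reverse_in 2 k u.
Proof.
elim: k f => [|k IHk] f f_std k_n /=.
  split=> // d v; split=> [f_v|[u f_u ->]].
    by exists v => //; rewrite /reverse_in; case: ifP => //; lia.
  by rewrite /reverse_in; case: ifP => //; lia.
have [g_std g_arm] := @promotion_hook k.+1 f f_std k_n.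
have [h_std h_arm] := IHk _ g_std (ltnW k_n); split=> // d v.
have [_ f_range _ _] := f_std.
have comp u : on_arm d f u -> reverse_in 2 k (rot_entry k.+1 u) = reverse_in 2 k.+1 u.
  move/f_range => u_n; rewrite /rot_entry.
  by case: leqP => ?; [case: eqP => ?|]; reverse_cases; lia.
rewrite h_arm; split=> [[u /g_arm[t f_t ->] ->]|[u f_u ->]].
  by exists t; rewrite ?comp.
by rewrite -comp //; exists (rot_entry k.+1 u) => //; apply/g_arm; exists u.
Qed.

(** With J = [l, h], the reversal of [2, h] carries [2, h - l + 1] onto [l + 1, h], so it conjugates
    the reversal of the former into that of the latter. *)
Lemma xi_hook (J : Defs.interval n) f : hook_standard f -> hook_standard (xi J f) /\
  forall d v, on_arm d (xi J f) v <->
    exists2 u, on_arm d f u & v = reverse_in (lo J).+1 (hi J) u.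
Proof.
move=> f_std; have [? ? hi_n] := intervalP J; rewrite /xi.
have [g_std g_arm] := xi1_hook f_std hi_n.
have [|h_std h_arm] := @xi1_hook (hi J - lo J).+1 _ g_std; first by lia.
have [l_std l_arm] := xi1_hook h_std hi_n; split=> // d v.
have [_ f_range _ _] := f_std.
have comp u : on_arm d f u -> reverse_in 2 (hi J) (reverse_in 2 (hi J - lo J).+1
    (reverse_in 2 (hi J) u)) = reverse_in (lo J).+1 (hi J) u.
  by move/f_range => u_n; reverse_cases; lia.
rewrite l_arm; split=> [[t /h_arm[s /g_arm[u f_u ->] ->] ->]|[u f_u ->]].
  by exists u; rewrite ?comp.
rewrite -comp //; exists (reverse_in 2 (hi J - lo J).+1 (reverse_in 2 (hi J) u)) => //.
by apply/h_arm; exists (reverse_in 2 (hi J) u) => //; apply/g_arm; exists u.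
Qed.

End Hook.

(** * The cactus group action on hook tableaux *)

Lemma move_setC m (s : 'S_m) A : move_set s (~: A) = ~: move_set s A.
Proof.
apply/setP => j; rewrite -[j](permKV s^-1%g) in_setC !(mem_imset _ _ perm_inj).
by rewrite in_setC.
Qed.

Section HookTableaux.
Local Open Scope nat_scope.
Variables a b : nat.
Local Notation lam := (hook a.+1 b).
Local Notation n := (a + b).+1.
Local Notation m := (a + b).
Local Notation box_on := (@box_on a b).
Local Notation arm_size := (arm_size a b).
Implicit Types (d : bool) (i j k v : nat) (f g : box lam -> nat) (x y : box lam).

Lemma syt_hook_standard (T : syt lam) : hook_standard (entry T).
Proof.
case: T => T T_std; have /and3P[T_perm /forallP rows /forallP cols] := T_std; pose f x : nat := T x.
have f_perm : perm_eq [seq f x | x : box lam] (iota 1 (sumn lam)) by [].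
rewrite -[entry _]/f.
have f_inj : injective f.
  by apply/injectiveP; rewrite /injectiveb /dinjectiveb (perm_uniq f_perm) iota_uniq.
have f_mem x : 1 <= f x <= n.
  have : f x \in iota 1 (sumn lam) by rewrite -(perm_mem f_perm) map_f ?mem_enum.
  by rewrite sumn_hook mem_iota add1n ltnS.
have mono d i j : i < j -> j < arm_size d -> f (box_on d i) < f (box_on d j).
  move=> ij j_lt; have [ri ci] := box_onE (ltn_trans ij j_lt).
  have [rj cj] := box_onE j_lt; case: d {j_lt} ri ci rj cj => /= ri ci rj cj.
    by have /forallP/(_ (box_on true j))/implyP := cols (box_on true i);
      apply; rewrite ri ci rj cj eqxx.
  by have /forallP/(_ (box_on false j))/implyP := rows (box_on false i);
    apply; rewrite ri ci rj cj eqxx.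
have f1 : f (corner a b) = 1.
  have : 1 \in [seq f x | x : box lam].
    by rewrite (perm_mem f_perm) sumn_hook mem_iota.
  case/mapP=> x _ x1; have [d [i [i_lt eq_x]]] := box_onP x.
  have [i0|i_gt0] := posnP i; first by rewrite x1 eq_x i0 box_on0.
  have := mono d 0 i i_gt0 i_lt; rewrite -eq_x -x1 box_on0.
  by have := f_mem (corner a b); lia.
split=> // [d v [i i_lt <-]|d i j /andP[_]|v [i i_lt <-] [j j_lt /f_inj]].
- have := f_mem (box_on d i); suff : f (box_on d i) != 1 by lia.
  by rewrite -f1 (inj_eq f_inj) -(box_on0 a b d); apply/eqP => /box_on_inj[]; lia.
- exact: mono.
by case/box_on_inj; lia.
Qed.

Lemma hook_standard_syt f : hook_standard f ->
  exists T : syt lam, entry T =1 f.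
Proof.
move=> f_std; have [f1 f_range f_mono _] := f_std.
have f_lt x : f x < (sumn lam).+1.
  have : f x \in [seq f y | y : box lam] by rewrite map_f ?mem_enum.
  by rewrite (perm_mem (hook_standard_perm f_std)) mem_iota sumn_hook add1n => /andP[].
pose T : {ffun box lam -> 'I_(sumn lam).+1} := [ffun x => Ordinal (f_lt x)].
have TE x : T x = f x :> nat by rewrite ffunE.
have mono d i j : i < j -> j < arm_size d -> f (box_on d i) < f (box_on d j).
  case: i => [|i] ij j_lt; last exact: f_mono.
  by rewrite box_on0 f1; apply: hook_standard_gt1; rewrite ?ij.
have T_std : standard T.
  apply/and3P; split.
  - have -> : [seq nat_of_ord (T x) | x : box lam] = [seq f x | x : box lam].
      by apply: eq_map => x; exact: TE.
    by rewrite sumn_hook; exact: hook_standard_perm.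
  - apply/forallP => x; apply/forallP => y; apply/implyP => /andP[/eqP].
    rewrite !TE; have [d [i [i_lt ->]]] := box_onP x; have [e [j [j_lt ->]]] := box_onP y.
    have [ri ci] := box_onE i_lt; have [rj cj] := box_onE j_lt; rewrite ri ci rj cj.
    case: d e i_lt j_lt {ri ci rj cj} => [] [] i_lt j_lt /=; try by lia.
      by move=> -> j_gt0; rewrite box_on0 -(box_on0 a b false); apply: mono.
    by move=> _ ij; apply: mono.
  apply/forallP => x; apply/forallP => y; apply/implyP => /andP[/eqP].
  rewrite !TE; have [d [i [i_lt ->]]] := box_onP x; have [e [j [j_lt ->]]] := box_onP y.
  have [ri ci] := box_onE i_lt; have [rj cj] := box_onE j_lt; rewrite ri ci rj cj.
  case: d e i_lt j_lt {ri ci rj cj} => [] [] i_lt j_lt /=; try by lia.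
    by move=> _ ij; apply: mono.
  by move=> -> j_gt0; rewrite box_on0 -(box_on0 a b true); apply: mono.
by exists (Sub T T_std).
Qed.

Definition arm_seq d f : seq nat := [seq f (box_on d i) | i <- iota 1 (arm_size d).-1].

Lemma mem_arm_seq d f v : v \in arm_seq d f <-> on_arm d f v.
Proof.
have size_gt0 : 0 < arm_size d by case: (d).
split=> [/mapP[i + ->]|[i i_lt <-]].
  by rewrite mem_iota => i_lt; exists i => //; lia.
by apply: map_f; rewrite mem_iota; lia.
Qed.

Lemma arm_seq_sorted d f : hook_standard f -> sorted ltn (arm_seq d f).
Proof.
case=> _ _ f_mono _; apply/(sortedP 0) => i; rewrite size_map size_iota => i_lt.
rewrite !(nth_map 0) ?size_iota ?nth_iota //; try by lia.
by apply: f_mono; lia.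
Qed.

(** The leg entries determine the arm entries as their complement in [2, n], and each arm lists its
    entries in increasing order. *)
Lemma hook_standard_eq f g : hook_standard f -> hook_standard g ->
  (forall v, on_arm true f v <-> on_arm true g v) -> f =1 g.
Proof.
move=> f_std g_std eq_leg; have [f1 _ _ _] := f_std; have [g1 _ _ _] := g_std.
have eq_arm d v : on_arm d f v <-> on_arm d g v.
  case: d => //; rewrite (on_arm_compl f_std) (on_arm_compl g_std).
  by split=> -[v_n] Nv; split=> // /eq_leg.
have eq_seq d : arm_seq d f = arm_seq d g.
  apply: (irr_sorted_eq ltn_trans ltnn); rewrite ?arm_seq_sorted // => v.
  by apply/idP/idP => /mem_arm_seq/eq_arm/mem_arm_seq.
move=> x; have [d [i [i_lt ->]]] := box_onP x.
have [->|i_gt0] := posnP i; first by rewrite box_on0 f1 g1.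
have := congr1 (nth 0 ^~ i.-1) (eq_seq d).
rewrite !(nth_map 0) ?size_iota; try by lia.
by rewrite nth_iota ?add1n ?prednK //; lia.
Qed.

(* The index i stands for the entry i + 2: 1 is always in the corner. *)
Definition leg_set f : {set 'I_m} := [set i : 'I_m | i.+2 \in arm_seq true f].

Lemma mem_leg_set f (i : 'I_m) : i \in leg_set f <-> on_arm true f i.+2.
Proof. by rewrite inE mem_arm_seq. Qed.

Lemma card_leg_set f : hook_standard f -> #|leg_set f| = b.
Proof.
move=> f_std; have [_ f_range _ _] := f_std.
transitivity (size (arm_seq true f)); last by rewrite size_map size_iota.
rewrite cardE -(size_map (fun i : 'I_m => i.+2)); apply/perm_size/uniq_perm.
- by rewrite map_inj_uniq ?enum_uniq // => i j [/ord_inj].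
- by apply: (sorted_uniq ltn_trans ltnn); exact: arm_seq_sorted.
move=> v; apply/mapP/idP => [[i + ->]|v_leg]; first by rewrite mem_enum inE.
have v_n := f_range _ _ (iffLR (mem_arm_seq _ _ _) v_leg).
have v_lt : v - 2 < m by lia.
by exists (Ordinal v_lt); rewrite ?mem_enum ?inE /=; rewrite (_ : (v - 2).+2 = v) //; lia.
Qed.

Lemma leg_set_surj (B : {set 'I_m}) : #|B| = b ->
  exists2 f, hook_standard f & leg_set f = B.
Proof.
move=> cardB; pose L d := [seq (val i).+2 | i : 'I_m <- enum (if d then B else ~: B)].
have size_L d : size (L d) = (arm_size d).-1.
  rewrite size_map -cardE; case: d => //=.
  by have := cardsC B; rewrite card_ord cardB => eq_m; apply: (@addnI b); rewrite eq_m addnC.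
have L_sorted d : sorted ltn (L d).
  rewrite /L (map_comp (fun i => i.+2) val) /=.
  rewrite !sorted_map /enum_mem -enumT.
  apply: sorted_filter => [i j k|]; first exact: ltn_trans.
  have := iota_ltn_sorted 0 m; rewrite -val_enum_ord sorted_map; exact: sub_sorted.
pose f (x : box lam) := if x == corner a b then 1 else
  if row_of x == 0 then nth 0 (L false) (col_of x).-1 else nth 0 (L true) (row_of x).-1.
have f_on d i : 0 < i < arm_size d -> f (box_on d i) = nth 0 (L d) i.-1.
  case/andP=> i_gt0 i_lt; have [ri ci] := box_onE i_lt; rewrite /f ri ci.
  case: eqP => [|_]; first by rewrite -(box_on0 a b d) => /box_on_inj[]; lia.
  by case: (d) => //; case: eqP i_gt0 => // ->.
have on_L d v : on_arm d f v <-> v \in L d.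
  split=> [[i i_lt <-]|]; first by rewrite f_on // mem_nth // size_L; lia.
  case/(nthP 0) => i; rewrite size_L => i_lt <-.
  by exists i.+1; rewrite ?f_on //; lia.
exists f; last first.
  apply/setP => i; apply/idP/idP => [/mem_leg_set/on_L/mapP[j + [/ord_inj->]]|i_B].
    by rewrite mem_enum.
  by apply/mem_leg_set/on_L; apply: (map_f (fun i : 'I_m => (val i).+2)); rewrite mem_enum.
split.
- by rewrite /f eqxx.
- move=> d v /on_L/mapP[i _ ->]; have := ltn_ord i; rewrite /=; lia.
- move=> d i j i_j j_lt; rewrite !f_on; try by lia.
  by apply: (sorted_ltn_nth ltn_trans 0 (L_sorted d)); rewrite ?inE ?size_L; lia.
move=> v /on_L/mapP[i + ->] /on_L/mapP[j + [/ord_inj eq_ij]].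
by rewrite !mem_enum eq_ij inE => /negbTE->.
Qed.

Lemma leg_set_inj (T U : syt lam) :
  leg_set (entry T) = leg_set (entry U) -> T = U.
Proof.
have T_std := syt_hook_standard T; have U_std := syt_hook_standard U.
move=> eq_TU; apply: val_inj; apply/ffunP => x; apply: ord_inj.
apply: (hook_standard_eq T_std U_std) => v.
have sub (P Q : syt lam) : hook_standard (entry P) ->
    leg_set (entry P) = leg_set (entry Q) ->
    on_arm true (entry P) v -> on_arm true (entry Q) v.
  move=> P_std eq_PQ P_v; have [_ P_range _ _] := P_std.
  have v_n := P_range _ _ P_v; have v_lt : v - 2 < m by lia.
  have eq_v : v = (Ordinal v_lt).+2 by rewrite /=; lia.
  by rewrite eq_v; apply/mem_leg_set; rewrite -eq_PQ; apply/mem_leg_set; rewrite -eq_v.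
by split; apply: sub.
Qed.

Lemma syt_leg_set (B : {set 'I_m}) :
  #|B| = b <-> exists T : syt lam, leg_set (entry T) = B.
Proof.
split=> [/leg_set_surj[f f_std <-]|[T <-]]; last exact/card_leg_set/syt_hook_standard.
have [T eq_T] := hook_standard_syt f_std; exists T.
by apply/setP => i; rewrite !inE /arm_seq (eq_map (fun i => eq_T (box_on true i))).
Qed.

(** Entry v corresponds to the point v - 1 of [1, n - 1], which turns the reversal of [l + 1, h]
    into that of [l, h - 1]; for h = l + 1 both are trivial. *)
Lemma leg_set_xi (J : Defs.interval n) f : hook_standard f ->
  leg_set (xi J f) = move_set (pi_gen J) (leg_set f).
Proof.
move=> f_std; have [_ f_range _ _] := f_std; have [_ xi_arm] := xi_hook J f_std.
(* The inverse in [move_set] is harmless on the involution [pi_gen J]. *)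
have -> : move_set (pi_gen J) (leg_set f) = pi_gen J @: leg_set f.
  have [sq _ _] := pi_gen_relations n.
  by rewrite /move_set (_ : (pi_gen J)^-1 = pi_gen J)%g //; apply: mulg1_eq.
have [lo_gt0 lt_J hi_n] := intervalP J.
apply/setP => i; apply/idP/imsetP => [/mem_leg_set/xi_arm[u u_f eq_i]|[j /mem_leg_set f_j ->]].
  have u_n := f_range _ _ u_f; have u_lt : u - 2 < m by lia.
  exists (Ordinal u_lt).
    by apply/mem_leg_set; rewrite /= (_ : (u - 2).+2 = u) //; lia.
  apply: ord_inj; apply: succn_inj; rewrite pi_genE /=.
  by move: eq_i; rewrite /reverse_in; repeat (case: ifP => ?); lia.
apply/mem_leg_set/xi_arm; exists j.+2 => //; have := pi_genE J j.
by rewrite /reverse_in => ->; repeat (case: ifP => ?); lia.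
Qed.

End HookTableaux.

(** * Permutation modules isomorphic to functions on k-subsets *)

Section PermIso.
Variables (F : numClosedFieldType) (m : nat) (H : groupType).
Variables (p : UMagmaMorphism.type H 'S_m) (X : finType) (rho : gset H X).
Variables (e : X -> {set 'I_m}) (k : nat).
Hypothesis e_inj : injective e.
Hypothesis e_card : forall B : {set 'I_m}, #|B| = k <-> exists x, e x = B.
Hypothesis e_act : forall h x, e (rho h x) = move_set (p h) (e x).

(** Transport along the injection e, extended by zero outside its image, the k-subsets. *)
Definition extend_sets (v : {ffun X -> F^o}) : {ffun {set 'I_m} -> F^o} :=
  [ffun B : {set 'I_m} => \sum_(x | e x == B) v x].

Fact extend_sets_linear :
  linear (extend_sets : perm_rep F rho -> perm_rep F (set_gset m)).
Proof.
move=> c u v; apply/ffunP => B; rewrite !ffunE scaler_sumr -big_split /=.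
by apply: eq_bigr => x _; rewrite !ffunE.
Qed.
HB.instance Definition _ := GRing.isLinear.Build F (perm_rep F rho)
  (perm_rep F (set_gset m)) *:%R extend_sets extend_sets_linear.

Lemma extend_setsE v x : extend_sets v (e x) = v x.
Proof.
by rewrite ffunE (big_pred1 x) // => y; rewrite (inj_eq e_inj).
Qed.

Lemma extend_sets_out v (B : {set 'I_m}) : #|B| != k -> extend_sets v B = 0.
Proof.
move=> Bk; rewrite ffunE big_pred0 // => x; apply: contraNF Bk => /eqP eB.
by apply/eqP/e_card; exists x.
Qed.

Lemma perm_rep_layer : rep_iso (perm_rep F rho) (rep_pull p (layer_rep m F k.+1)).
Proof.
apply: (@rep_iso_pull_subrep _ _ _ p (perm_rep F rho) (perm_rep F (set_gset m)) _
  (@layer_stable m F k.+1) extend_sets).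
- move=> h v; apply/ffunP => B; rewrite [RHS]ffunE.
  have [/e_card[x <-]|Bk] := eqVneq #|B| k.
    rewrite extend_setsE ffunE -(extend_setsE v) e_act; congr (extend_sets v _).
    by rewrite gmulfV.
  by rewrite !extend_sets_out // [#|_|]card_move_set.
- move=> u v eq_uv; apply/ffunP => x.
  by rewrite -(extend_setsE u) -(extend_setsE v) eq_uv.
- by move=> v; apply/layerP => B; rewrite eqSS; exact: extend_sets_out.
move=> u /layerP u0; exists [ffun x => u (e x)]; apply/ffunP => B.
have [/e_card[x <-]|Bk] := eqVneq #|B| k; first by rewrite extend_setsE ffunE.
by rewrite extend_sets_out // u0.
Qed.

End PermIso.

Section HookAction.
Variables a b : nat.
Local Notation lam := (hook a.+1 b).
Local Notation n := (a + b).+1.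

(** The action is pulled back through the bijection of tableaux with b-subsets, so the group laws
    come from [cactus_pi]. *)
Lemma hook_action : exists rho : gset (cactus n) (syt lam),
  forall g T, leg_set (entry (rho g T)) = move_set (cactus_pi n g) (leg_set (entry T)).
Proof.
have act_ex (gT : cactus n * syt lam) : exists U : syt lam,
    leg_set (entry U) = move_set (cactus_pi n gT.1) (leg_set (entry gT.2)).
  apply/syt_leg_set; rewrite card_move_set; apply/syt_leg_set; by exists gT.2.
have [r rP] := boolp.choice act_ex.
have r1 T : r (1%g, T) = T.
  by apply: leg_set_inj; rewrite rP gmulf1 move_set1.
have rM g h T : r ((g * h)%g, T) = r (g, r (h, T)).
  by apply: leg_set_inj; rewrite !rP gmulfM move_setM.
by exists (@GSet _ _ (fun g T => r (g, T)) r1 rM) => g T; rewrite rP.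
Qed.

End HookAction.

Theorem theorem1p2 (R : realType) (n a b : nat) (hn : (2 <= n)%N)
    (ha : (1 <= a)%N) (hab : (a + b)%N = n)
    (hne : hook a b <> [:: 2%N; 1%N]) :
  exists2 rho : gset (cactus n) (syt (hook a b)),
    schutzenberger_action rho &
    rep_iso (perm_rep R[i] rho)
      (\big[@rep_dsum _ _ / @rep_zero _ _]_(mu : intpart n.-1)
         rep_copies (kostka mu [:: a.-1; b])
           (rep_pull (cactus_pi n) (specht R[i] n.-1 mu))).
Proof.
case: a ha hab hne => // a _ <- _ {n} in hn *.
have [rho rhoP] := hook_action a b; exists rho.
  move=> J T; have T_std := syt_hook_standard T.
  have [xi_std _] := xi_hook J T_std; have [U eq_U] := hook_standard_syt xi_std.
  suff -> : rho (cgen J) T = U by [].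
  apply: leg_set_inj; rewrite rhoP cactus_pi_cgen -(leg_set_xi J T_std).
  by apply/setP => i; rewrite !inE /arm_seq (eq_map (fun i => eq_U (box_on a b true i))).
have m_gt0 : (0 < a + b)%N by [].
apply: rep_iso_trans (@young_rule _ _ _ (cactus_pi (a + b).+1) m_gt0 a b erefl).
(* The subsets must have size [minn a b]: when a <= b the complement of the leg, which encodes the
   arm, replaces the leg. *)
have [ab|ba] := leqP a b.
  apply: (@perm_rep_layer _ _ _ _ _ _ (fun T => ~: leg_set (entry T))).
  - by move=> T U /setC_inj/leg_set_inj.
  - move=> B; split=> [cardB|[T <-]].
      have /syt_leg_set[T eq_T] : #|~: B| = b.
        by have := cardsC B; rewrite cardB card_ord => /addnI.
      by exists T; rewrite eq_T setCK.
    have := cardsC (leg_set (entry T)).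
    by rewrite (iffRL (syt_leg_set _)); [rewrite card_ord addnC => /addIn | exists T].
  - by move=> g T; rewrite rhoP move_setC.
apply: (@perm_rep_layer _ _ _ _ _ _ (fun T => leg_set (entry T))).
- exact: leg_set_inj.
- exact: syt_leg_set.
- exact: rhoP.
Qed.
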